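(* Let $A$ be the ring of integers in a global field, let $K$ be the quotient field of $A$, let $G\subseteq GL_n(A)$ be a finite group acting linearly on $R=A[X_1,\ldots,X_n]$ (fixing $A$), and let $S=R^G$. Assume there does not exist a non-trivial group homomorphism $G \to K^*$. Then the canonical homomorphism $i\colon C(S)\to C(R)$ of class groups is injective. Furthermore, if $C(A)\neq 0$ then $C(S)\neq 0$.
   Context: ''$A$ is the ring of integers in a global field'' means that either $A$ is the ring of integers of a number field, or $A$ is the ring of integers (the integral closure of $\mathbb{F}_q[t]$) of a finite extension of $\mathbb{F}_q(t)$, with $\mathbb{F}_q$ a finite field. $G$ acts on $R$ by graded $A$-algebra automorphisms (variables in degree $1$), acting on $R_1=\bigoplus_i AX_i$ through $G\subseteq GL_n(A)$. For a Noetherian integrally closed domain $T$, let $X(T)$ be the free abelian group on the height one primes of $T$, $P(T)$ the subgroup of principal divisors, and $C(T)=X(T)/P(T)$ the class group. Let $T\subseteq U$ be integrally closed domains with $U$ a finitely generated $T$-module. For a height one prime $Q$ of $U$ set $e(Q)=\ell\big(U_Q/(Q\cap T)U_Q\big)$ (length). For a height one prime $\mathfrak{q}$ of $T$ set $i(\mathfrak{q})=\sum_{Q\cap T=\mathfrak{q}} e(Q)\,Q$ (sum over height one primes $Q$ of $U$ lying over $\mathfrak q$), and extend linearly to $i\colon X(T)\to X(U)$. This maps $\operatorname{div}_T(a)$ to $\operatorname{div}_U(a)$ for $a \in T$ nonzero, hence induces a homomorphism $i\colon C(T)\to C(U)$. The map in the claim is the case $T=S$, $U=R$. *)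

(* Defs.v *)
(* MathComp with multinomials; mathcomp-classical makes the type of height one
   primes a choiceType, as {freeg _} requires. *)
From HB Require Import structures.
From mathcomp Require Export all_boot all_order all_algebra all_fingroup.
From mathcomp Require Export fieldext mxrepresentation.
From mathcomp Require Export boolp classical_sets functions cardinality fsbigop.
From mathcomp Require Export freeg mpoly.

Set Implicit Arguments.
Unset Strict Implicit.
Unset Printing Implicit Defensive.

Import GRing.Theory.
Local Open Scope ring_scope.
Local Open Scope classical_set_scope.

(** * Rings of integers in global fields *)

Section GlobalFields.
Variable A : idomainType.

Definition is_integral_closure (B : nzRingType) (L : fieldType) (h : B -> L) :=
  exists f : {rmorphism A -> L},
    injective f /\ forall x : L, (exists a, f a = x) <-> integralOver h x.

(* [fieldExtType k] is the type of finite extensions of [k]. *)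
Definition is_number_ring :=
  exists L : fieldExtType rat, is_integral_closure (fun z : int => z%:~R : L).

Definition is_function_ring :=
  exists (Fq : finFieldType) (L : fieldExtType {fraction {poly Fq}}),
    is_integral_closure (fun p : {poly Fq} => (tofrac p)%:A : L).

Definition is_global_ring_of_integers := is_number_ring \/ is_function_ring.

End GlobalFields.

(** * Height one primes *)

Section HeightOne.
Variable T : idomainType.

Definition prime_ideal (P : {pred T}) : Prop :=
  idealr_closed P /\ prime_idealr_closed P.

Definition prime_chain (P : {pred T}) (k : nat) : Prop :=
  exists c : nat -> {pred T},
    [/\ c k =i P,
        forall i, (i <= k)%N -> prime_ideal (c i)
      & forall i, (i < k)%N ->
          {subset c i <= c i.+1} /\ ~ {subset c i.+1 <= c i}].

Definition has_height (P : {pred T}) (h : nat) : Prop :=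
  prime_chain P h /\ forall k, prime_chain P k -> (k <= h)%N.

Record height1 : Type := Height1 {
  height1_pred :> {pred T};
  height1_prime : prime_ideal height1_pred;
  height1_height : has_height height1_pred 1 }.

HB.instance Definition _ := gen_eqMixin height1.
HB.instance Definition _ := gen_choiceMixin height1.

End HeightOne.

(** * Localization and length *)

Section Length.
Variables (F : fieldType) (V : set F).

(* When [V] is (the carrier of) a subring of [F]. *)
Definition is_submod (J : set F) : Prop :=
  [/\ J 0, forall x y, J x -> J y -> J (x + y)
    & forall v x, V v -> J x -> J (v * x)].

Definition submod_span (X : set F) : set F :=
  [set x | forall J : set F, is_submod J -> X `<=` J -> J x].

(* Submodules of M / N are encoded as submodules of M containing N, so that
   these are the strict chains of length [k] from 0 to the module M / N. *)
Definition submod_chain (M N : set F) (k : nat) : Prop :=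
  exists c : nat -> set F,
    [/\ c 0%N = N, c k = M,
        forall i, (i <= k)%N -> is_submod (c i)
      & forall i, (i < k)%N -> c i `<` c i.+1].

(* The length of M / N; the value is a dummy 0 if that length is infinite,
   which does not occur for the quotients of discrete valuation rings by
   nonzero ideals considered below. *)
Definition quo_length (M N : set F) : nat :=
  xget 0%N [set k | submod_chain M N k /\
                    forall m, submod_chain M N m -> (m <= k)%N].

End Length.

Definition localization (T : idomainType) (P : {pred T}) : set {fraction T} :=
  [set x | exists a s : T, s \notin P /\ x = tofrac a / tofrac s].

(** * Divisors and class groups *)

(* X(T) *)
Notation divgroup T := {freeg (height1 T)}.

Section ClassGroup.
Variable T : idomainType.

Definition valuation (P : height1 T) (a : T) : nat :=
  let TP := localization P in
  quo_length TP TP (submod_span TP [set tofrac a]).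

(* [\sum_(P \in D) _] is a sum over the elements of [D] where the summand is
   nonzero; it is a dummy 0 if there are infinitely many of these. *)
Definition div_of (a : T) : divgroup T :=
  \sum_(P \in [set: height1 T]) << (valuation P a)%:Z *g P >>.

(* P(T), as the subgroup of X(T) generated by the div(a), 0 != a \in T; as
   div(a / b) = div(a) - div(b), this is the group of the divisors of the
   nonzero elements of the quotient field. *)
Definition principal : {pred divgroup T} :=
  fun D => `[< forall H : {pred divgroup T}, zmod_closed H ->
                 (forall a : T, a != 0 -> div_of a \in H) -> D \in H >].

Fact principal_zmod_closed : zmod_closed principal.
Proof.
split=> [|x y /asboolP Px /asboolP Py]; apply/asboolP => H HZ HT.
  by case: HZ.
by have [_ HB] := HZ; apply: HB; [apply: Px | apply: Py].
Qed.
HB.instance Definition _ :=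
  GRing.isZmodClosed.Build (divgroup T) principal principal_zmod_closed.

End ClassGroup.

(* C(T) *)
Notation classgroup T := (Quotient.quot (@principal T)).

Definition divclass (T : idomainType) (D : divgroup T) : classgroup T :=
  (\pi_(classgroup T) D)%qT.

(** * The canonical homomorphism for T included in U by phi *)

Section Extension.
Variables (T U : idomainType) (phi : {rmorphism T -> U}).

Definition contraction (Q : {pred U}) : {pred T} := fun a => phi a \in Q.

(* e(Q) *)
Definition ramification (Q : height1 U) : nat :=
  let UQ := localization Q in
  quo_length UQ UQ
    (submod_span UQ [set tofrac (phi a) | a in [set a | a \in contraction Q]]).

Definition prime_ext (q : height1 T) : divgroup U :=
  \sum_(Q \in [set Q : height1 U | contraction Q =i q])
     << (ramification Q)%:Z *g Q >>.

(* i : X(T) -> X(U) *)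
Definition divext (D : divgroup T) : divgroup U := fglift prime_ext D.

Definition is_induced_by_divext
    (i : {additive classgroup T -> classgroup U}) : Prop :=
  forall D : divgroup T, i (divclass D) = divclass (divext D).

End Extension.

(** * The ring of invariants *)

Section Invariants.
Variables (A : idomainType) (n : nat).

(* M acts on R_1 = \bigoplus_i A X_i as on column vectors, so that
   mx_act (M *m N) = mx_act M \o mx_act N. *)
Definition mx_act (M : 'M[A]_n) (p : {mpoly A[n]}) : {mpoly A[n]} :=
  p \mPo [tuple \sum_(i < n) M i j *: 'X_i | j < n].

HB.instance Definition _ M :=
  GRing.LRMorphism.copy (mx_act M)
    (comp_mpoly [tuple \sum_(i < n) M i j *: 'X_i | j < n]).

Variables (gT : finGroupType) (G : {group gT}) (rho : mx_representation A G n).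

Definition invariant : {pred {mpoly A[n]}} :=
  fun p => [forall g in G, mx_act (rho g) p == p].

Fact invariant_divring_closed : divring_closed invariant.
Proof.
have invP p : reflect {in G, forall g, mx_act (rho g) p = p} (p \in invariant).
  exact: 'forall_in_eqP.
split=> [|p q /invP Gp /invP Gq|p q /invP Gp /invP Gq]; apply/invP => g gG.
- by rewrite rmorph1.
- by rewrite rmorphB /= (Gp _ gG) (Gq _ gG).
rewrite rmorphM /= (Gp _ gG); congr (_ * _).
have [q_unit|q_nunit] := boolP (q \is a GRing.unit).
  by rewrite rmorphV //= (Gq _ gG).
by rewrite invr_out // (Gq _ gG).
Qed.
HB.instance Definition _ :=
  GRing.isDivringClosed.Build {mpoly A[n]} invariant invariant_divring_closed.

Record invring : Type := Invring {
  invring_val :> {mpoly A[n]}; _ : invring_val \in invariant }.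

HB.instance Definition _ := [isSub for invring_val].
HB.instance Definition _ := [Choice of invring by <:].
HB.instance Definition _ := [SubChoice_isSubIntegralDomain of invring by <:].
HB.instance Definition _ := GRing.RMorphism.copy invring_val (val : invring -> _).

End Invariants.

(* Main.v *)
(** Call a domain Krull if its localizations at height one primes are discrete
    valuation rings, it is their intersection, and every nonzero element lies
    in finitely many height one primes.  A ring of integers [A] is Krull
    because it is integrally closed with finite residue rings; Gauss's lemma
    carries this over to [A[X]] and hence to [R = A[X_1, ..., X_n]].  By prime
    avoidance the height one primes of [R] over a given height one prime of
    [S = R^G] form a single [G]-orbit, so that for every height one prime [Q]
    of [R] the valuation of [Q] restricts on [S] to [e(Q)] times the valuation
    of the height one prime [Q \cap S].  Thus [i] is injective on divisors and
    maps [div_S(a)] to [div_R(a)].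

    If [i(D) = div_R(f)], then [i(D)] is [G]-invariant, so [g f / f] is a unit
    of [R], that is, a nonzero constant, and [g |-> g f / f] is a character of
    [G].  It is trivial, hence [f] lies in the fraction field of [S] and
    [D = div_S(f)].

    If [p] is a nonprincipal height one prime of [A], then [Q = pR] is
    [G]-stable and unramified over [q = Q \cap S], since a uniformizer of [p]
    lies in [S]; so [i(q) = Q].  If [q] were principal, so would be [Q], and a
    generator of [Q] would be a constant generating [p]. *)

Require Import Defs.
From HB Require Import structures.
From mathcomp Require Import qpoly.

Set Implicit Arguments.
Unset Strict Implicit.
Unset Printing Implicit Defensive.

Import Order.TTheory GRing.Theory Num.Theory.
Local Open Scope ring_scope.

(** An extension of F_q(t) may be inseparable, so the trace form cannot be used to show that [A] is
    a finitely generated module over [B], the ring of integers or F_q[t]. Finiteness of the residue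
    rings comes instead from a bound that ignores generators: if the finite type [X] separates the
    classes of [B] modulo [b] and [d] is the degree of the extension, a [B]-submodule of [L] has at
    most |X|^d elements pairwise incongruent modulo [b]. Finite residue rings then serve three
    times: a repetition among the c (b/a)^k modulo [c] makes almost integral elements integral, a
    repetition among the powers of an element makes nonzero primes maximal, and colon ideals over a
    nonzero [a] have maximal members, which replaces the Noetherian property. A domain is recognized
    as Krull from any suitable family of valuations, before its height one primes are known: an
    element outside a prime p absorbs the finitely many relevant valuations not lying over p, so
    every nonzero prime contains a member of the family. The same argument, run for S inside R,
    finds a prime of R over each height one prime of S. *)

Ltac mulAC :=
  (* The appended [1] makes every factor, the last one included, the left operand of a product, so
     that the loop can cancel it. *)
  rewrite -[LHS]mulr1 -[RHS]mulr1 -?mulrA;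
  repeat match goal with
  | |- ?a * ?x = ?b * ?y =>
      first [ unify a b; apply: (congr1 (GRing.mul a))
            | rewrite [in RHS](mulrCA _ a) ]
  end; reflexivity.

(** * Primes whose localization is a discrete valuation ring *)

Section PrimeIdeal.
Variables (T : idomainType) (P : {pred T}) (hP : prime_ideal P).

Lemma prime0 : 0 \in P. Proof. by have [[]] := hP. Qed.

Lemma prime1 : 1 \notin P. Proof. by have [[]] := hP. Qed.

Lemma primeMl a x : x \in P -> a * x \in P.
Proof.
by move=> xP; have [[P0 _ PD] _] := hP; rewrite -[a * x]addr0; apply: PD.
Qed.

Lemma primeMr a x : x \in P -> x * a \in P.
Proof. by rewrite mulrC; apply: primeMl. Qed.

Lemma primeD x y : x \in P -> y \in P -> x + y \in P.
Proof.
by move=> xP yP; have [[_ _ PD] _] := hP; rewrite -[x]mul1r; apply: PD.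
Qed.

Lemma primeN x : (- x \in P) = (x \in P).
Proof.
apply/idP/idP => /(primeMl (-1)); rewrite mulN1r ?opprK //.
Qed.

Lemma primeB x y : x \in P -> y \in P -> x - y \in P.
Proof. by move=> xP yP; apply: primeD; rewrite ?primeN. Qed.

Lemma prime_sum I (r : seq I) (Q : pred I) (F : I -> T) :
  (forall i, Q i -> F i \in P) -> \sum_(i <- r | Q i) F i \in P.
Proof.
move=> FP; elim/big_rec: _ => [|i x /FP ? ?]; [exact: prime0|exact: primeD].
Qed.

Lemma primeM x y : (x * y \in P) = (x \in P) || (y \in P).
Proof.
apply/idP/idP => [|/orP[]]; last 2 first.
- exact: primeMr.
- exact: primeMl.
by have [_ hM] := hP; apply: hM.
Qed.

Lemma primeX x k : (x ^+ k \in P) = (0 < k)%N && (x \in P).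
Proof.
elim: k => [|k IH]; first by rewrite expr0 (negbTE prime1).
by rewrite exprS primeM IH /=; case: (x \in P); rewrite ?andbF.
Qed.

Lemma prime_prod I (r : seq I) (Q : pred I) (F : I -> T) :
  (forall i, Q i -> F i \notin P) -> \prod_(i <- r | Q i) F i \notin P.
Proof.
move=> FP; elim/big_rec: _ => [|i x /FP Fi xP]; first exact: prime1.
by rewrite primeM negb_or Fi.
Qed.

Lemma notin_prime_neq0 x : x \notin P -> x != 0.
Proof. by apply: contraNneq => ->; apply: prime0. Qed.

End PrimeIdeal.

Section Uniformizer.
Variable T : idomainType.
Implicit Types (P : {pred T}) (x y pi : T).

(** The equation x = pi^k (r / s), with r / s a unit of the localization at [P], cleared of
    denominators; values are thus defined on [T] itself. *)
Definition is_ord P pi x k :=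
  exists s r, [/\ s \notin P, r \notin P & s * x = pi ^+ k * r].

(* [pi] generates the maximal ideal of the localization at [P], which is a
   discrete valuation ring. *)
Definition dvr_at P pi :=
  [/\ prime_ideal P, pi \in P, pi != 0
    & forall x, x != 0 -> exists k, is_ord P pi x k].

Definition dvr P := exists pi, dvr_at P pi.

Definition unif P : T := xget 0 [set pi | dvr_at P pi]%classic.

(* [vord P 0] is a junk value. *)
Definition vord P x : nat := xget 0%N [set k | is_ord P (unif P) x k]%classic.

Lemma unifP P : dvr P -> dvr_at P (unif P).
Proof. by case=> pi hpi;
  apply: (xgetPex 0 (P := [set pi | dvr_at P pi]%classic)); exists pi. Qed.

Lemma dvr_prime P : dvr P -> prime_ideal P. Proof. by case=> pi []. Qed.

Lemma is_ord_uniq P pi x k k' :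
  dvr_at P pi -> x != 0 -> is_ord P pi x k -> is_ord P pi x k' -> k = k'.
Proof.
move=> [hP piP pi0 _] x0.
wlog lek : k k' / (k <= k')%N.
  move=> H h h'; case/orP: (leq_total k k') => le; [exact: H|symmetry;
    exact: H].
move=> [s [r [sP rP e]]] [s' [r' [sP' rP' e']]].
apply/eqP; rewrite eqn_leq lek /= leqNgt; apply/negP => lt.
have /(mulfI (expf_neq0 k pi0)) e2 :
    pi ^+ k * (s' * r) = pi ^+ k * (pi ^+ (k' - k) * (s * r')).
  rewrite !mulrA -exprD subnKC // mulrAC -mulrA [r * s']mulrC.
  by rewrite mulrCA -e mulrCA e' mulrCA mulrA.
have : s' * r \in P by rewrite e2 primeMr // primeX // subn_gt0 lt.
by rewrite primeM // (negbTE sP') (negbTE rP).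
Qed.

Section Vord.
Variables (P : {pred T}) (hP : dvr P).
Let pP := dvr_prime hP.

Lemma vordP x : x != 0 -> is_ord P (unif P) x (vord P x).
Proof.
move=> x0; apply: (xgetPex 0%N (P := [set k | is_ord P (unif P) x k]%classic)).
by have [_ _ _ /(_ x x0)] := unifP hP.
Qed.

Lemma vord_unif_eq x k : x != 0 -> is_ord P (unif P) x k -> vord P x = k.
Proof. by move=> x0 h; apply: is_ord_uniq (unifP hP) x0 (vordP x0) h. Qed.

Lemma vordM x y : x != 0 -> y != 0 -> vord P (x * y) = (vord P x + vord P y)%N.
Proof.
move=> x0 y0; have [s [r [sP rP e]]] := vordP x0.
have [s' [r' [sP' rP' e']]] := vordP y0.
apply: vord_unif_eq; first by rewrite mulf_neq0.
exists (s * s'), (r * r'); split; rewrite ?primeM ?negb_or ?sP ?rP //.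
by rewrite mulrACA e e' exprD mulrACA.
Qed.

Lemma vord_eq0 x : x != 0 -> (vord P x == 0%N) = (x \notin P).
Proof.
move=> x0; have [s [r [sP rP e]]] := vordP x0.
have [_ uP _ _] := unifP hP.
have : (s * x \in P) = (0 < vord P x)%N.
  by rewrite e primeM // primeX // (negbTE rP) orbF uP andbT.
by rewrite primeM // (negbTE sP) /= => ->; rewrite lt0n negbK.
Qed.

Lemma vord_notin x : x \notin P -> vord P x = 0%N.
Proof.
by move=> xP; apply/eqP; rewrite vord_eq0 ?(notin_prime_neq0 pP xP).
Qed.

Lemma vord_gt0 x : x != 0 -> (0 < vord P x)%N = (x \in P).
Proof. by move=> x0; rewrite lt0n vord_eq0 // negbK. Qed.

Lemma vordX x k : x != 0 -> vord P (x ^+ k) = (k * vord P x)%N.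
Proof.
move=> x0; elim: k => [|k IH]; first by rewrite vord_notin // (prime1 pP).
by rewrite exprS vordM ?expf_neq0 // IH mulSn.
Qed.

(** Independence of the value from the uniformizer: applied to [unif P], whose value is 1, the
    formula [gen] writes 1 as a multiple of [vord P pi]. *)
Lemma vord_dvr_at pi x k :
  dvr_at P pi -> x != 0 -> is_ord P pi x k -> vord P x = k.
Proof.
have gen y j : dvr_at P pi -> y != 0 -> is_ord P pi y j ->
  vord P y = (j * vord P pi)%N.
  move=> [_ piP pi0 _] y0 [s [r [sP rP e]]].
  have s0 := notin_prime_neq0 pP sP; have r0 := notin_prime_neq0 pP rP.
  move/(congr1 (vord P)): e.
  by rewrite !vordM ?expf_neq0 // vordX // (vord_notin sP) (vord_notin rP)
    addn0.
move=> hpi x0 h; rewrite (gen _ _ hpi x0 h).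
suff /eqP -> : vord P pi == 1%N by rewrite muln1.
have [_ _ u0 _] := unifP hP; have [_ _ pi0 hx] := hpi.
have [j hj] := hx _ u0; have := gen _ _ hpi u0 hj.
have -> : vord P (unif P) = 1%N.
  apply: vord_unif_eq => //; exists 1, 1; rewrite expr1 mul1r mulr1.
  by rewrite (prime1 pP).
by move/esym/eqP; rewrite muln_eq1 => /andP[].
Qed.

Lemma vord_at pi : dvr_at P pi -> vord P pi = 1%N.
Proof.
move=> hpi; have [_ _ pi0 _] := hpi; apply: (vord_dvr_at hpi) => //.
by exists 1, 1; rewrite expr1 mul1r mulr1 (prime1 pP).
Qed.

Lemma vord_leP x y : x != 0 -> y != 0 ->
  (vord P x <= vord P y)%N <-> exists s r, s \notin P /\ s * y = x * r.
Proof.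
move=> x0 y0; split=> [le|[s [r [sP e]]]]; last first.
  have s0 := notin_prime_neq0 pP sP.
  have r0 : r != 0.
    by apply: contraTneq (mulf_neq0 s0 y0) => r0; rewrite e r0 mulr0 eqxx.
  move/(congr1 (vord P)): e; rewrite !vordM // (vord_notin sP) add0n => ->.
  exact: leq_addr.
have [s [r [sP rP e]]] := vordP x0; have [s' [r' [sP' rP' e']]] := vordP y0.
exists (s' * r), (unif P ^+ (vord P y - vord P x) * (r' * s)).
split; first by rewrite primeM // negb_or sP' rP.
have [_ _ u0 _] := unifP hP.
rewrite mulrAC e' -{1}(subnK le) exprD.
transitivity (unif P ^+ (vord P y - vord P x) * r' * (s * x)); last by mulAC.
by rewrite e; mulAC.
Qed.
End Vord.
End Uniformizer.

(** * Height one primes and families of valuations *)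

Section Height.
Variable T : idomainType.
Implicit Types (P : {pred T}).

Lemma zero_prime : prime_ideal ([pred x | x == 0] : {pred T}).
Proof.
split; first split; rewrite ?inE ?oner_eq0 //.
- by move=> a u v; rewrite !inE => /eqP-> /eqP->; rewrite mulr0 addr0.
- by move=> u v; rewrite !inE mulf_eq0.
Qed.

(** Up to factors outside [P], hence outside [P'], a nonzero [x] in [P'] is a power of the
    uniformizer; so [P'] contains the uniformizer, and with it every element of positive value. *)
Lemma dvr_minimal P (P' : {pred T}) x : dvr P -> prime_ideal P' ->
  x \in P' -> x != 0 -> {subset P' <= P} -> {subset P <= P'}.
Proof.
move=> [pi [hP piP pi0 hx]] hP' xP' x0 subP.
have nP' y : y \notin P -> y \notin P' by apply: contra; apply: subP.
have piP' : pi \in P'.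
  have [k [s [r [_ /nP' rP e]]]] := hx _ x0.
  have : s * x \in P' by rewrite primeMl.
  by rewrite e primeM // (negbTE rP) orbF primeX // => /andP[].
move=> y yP; have [->|y0] := eqVneq y 0; first exact: prime0.
have [[|k] [s [r [sP rP e]]]] := hx _ y0.
  by move: rP; rewrite -[r]mul1r -(expr0 pi) -e primeMl.
have : s * y \in P' by rewrite e primeMr // primeX.
by rewrite primeM // (negbTE (nP' _ sP)).
Qed.

Lemma height1_neq0 (P : height1 T) : exists2 x, x \in P & x != 0.
Proof.
have [[c [ck hc sc]] _] := height1_height P.
have [s01 /existsNP[x /not_implyP[x1 x0]]] := sc 0%N isT.
exists x; first by rewrite -ck.
by apply: contra_not_neq x0 => ->; apply: prime0; apply: hc.
Qed.

Lemma dvr_neq0 P : dvr P -> exists2 x, x \in P & x != 0.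
Proof. by case=> pi [_ piP pi0 _]; exists pi. Qed.

(** Otherwise 0, [P'], [P] would be a chain of length 2. *)
Lemma height1_minimal (P : height1 T) (P' : {pred T}) x : prime_ideal P' ->
  x \in P' -> x != 0 -> {subset P' <= P} -> {subset P <= P'}.
Proof.
move=> hP' xP' x0 sP; apply: contrapT => nsP.
have [_ /(_ 2%N)] := height1_height P; apply: contraPP => _ /(_ _)H.
suff /H : prime_chain P 2 by [].
exists (fun i => nth (P : {pred T}) [:: [pred x | x == 0] : {pred T}; P'] i).
split=> //.
- by case=> [|[|[|i]]] //= _; [exact: zero_prime|exact: height1_prime].
- case=> [|[|i]] //= _; split=> //.
    by move=> y; rewrite inE => /eqP->; apply: prime0.
  by move=> /(_ _ xP'); rewrite inE (negbTE x0).
Qed.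

Lemma dvr_height1 P : dvr P -> has_height P 1.
Proof.
move=> hP; split.
  exists (fun i => if i is 0%N then [pred x | x == 0] : {pred T} else P).
  split=> //; first by case=> [_|i _]; [exact: zero_prime|exact: dvr_prime].
  case=> //= _; split; first by move=> y; rewrite inE => /eqP->;
    apply/prime0/dvr_prime.
  have [x xP x0] := dvr_neq0 hP.
  by move/(_ _ xP); rewrite inE (negbTE x0).
(* In a chain of length at least 2, [c 1] is a nonzero prime inside [P], so it contains [P] by
   [dvr_minimal]; this leaves no room for the strict step to [c 2]. *)
move=> k [c [ck hc sc]]; rewrite leqNgt; apply/negP => k2.
have sub i : (i <= k)%N -> {subset c (k - i)%N <= P}.
  elim: i => [_|i IH ik] x; first by rewrite subn0 ck.
  move=> xc; apply: (IH (ltnW ik)).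
  have lt : (k - i.+1 < k)%N by rewrite ltn_subrL (ltnW k2).
  have [sc1 _] := sc _ lt.
  by move: sc1; rewrite -subSn // subSS; apply.
have k1 : (0 < k)%N by apply: ltnW.
have [s01 /existsNP[x /not_implyP[x1 x0]]] := sc 0%N k1.
have [s12 /existsNP[y /not_implyP[y2 y1]]] := sc 1%N k2.
have c0 : prime_ideal (c 0%N) by apply: hc.
have x_neq0 : x != 0 by apply: contra_not_neq x0 => ->; apply: prime0.
apply: y1; apply: (dvr_minimal hP (hc 1%N _) x1 x_neq0).
- by apply: ltnW.
- by have := @sub (k - 1)%N (leq_subr _ _); rewrite subKn.
- by have := @sub (k - 2)%N (leq_subr _ _); rewrite subKn //; apply.
Qed.

Definition height1_of P (hP : dvr P) : height1 T :=
  Height1 (dvr_prime hP) (dvr_height1 hP).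

Lemma height1_eq (P Q : height1 T) : P =i Q -> P = Q.
Proof.
case: P Q => [P hP hP'] [Q hQ hQ'] /= PQ.
have ePQ : P = Q by apply/funext => x; exact: PQ.
by subst Q; congr Height1; apply: Prop_irrelevance.
Qed.

Lemma height1_eq_sub (P Q : height1 T) : {subset P <= Q} -> P = Q.
Proof.
move=> PQ; apply: height1_eq => x; apply/idP/idP; first exact: PQ.
have [y yP y0] := height1_neq0 P.
exact: (height1_minimal (height1_prime P) yP y0 PQ).
Qed.

End Height.

Section Families.
Variables (T : idomainType).

Definition finite_char (I : eqType) (c : I -> {pred T}) :=
  forall x, x != 0 -> finite_set [set i | x \in c i]%classic.

(* [T] is the intersection of the valuation rings of the family. *)
Definition vord_div (I : Type) (c : I -> {pred T}) :=
  forall x y, x != 0 -> y != 0 ->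
    (forall i, (vord (c i) x <= vord (c i) y)%N) -> exists z, y = x * z.

(** The family is arbitrary so that the Krull property can be verified on explicitly known primes;
    [family_krull] passes to the height one primes. *)
Definition dvr_family (I : eqType) (c : I -> {pred T}) :=
  [/\ forall i, dvr (c i), finite_char c & vord_div c].

Definition krull := dvr_family (@height1_pred T).

End Families.

Lemma contractionE (S R : idomainType)
    (phi : {rmorphism S -> R}) (Q : {pred R}) x :
  (x \in contraction phi Q) = (phi x \in Q).
Proof. by []. Qed.

(** * Divisibility locally at a prime, read off from valuations of a larger ring *)

Section LocalDivision.
Variables (S R : idomainType) (phi : {rmorphism S -> R}).
Hypothesis phi_inj : injective phi.
Hypothesis phi_div : forall (x y : S) (z : R), x != 0 -> phi y = phi x * z ->
  exists w, y = x * w.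
Variables (I : eqType) (c : I -> {pred R}) (hc : dvr_family c).
Variables (p : {pred S}) (hp : prime_ideal p).

(* [s] is chosen in the finitely many [c i] that contain [phi x] and do not
   contract into [p]. *)
Lemma local_div (x y : S) : x != 0 -> y != 0 ->
  (forall i, {subset contraction phi (c i) <= p} ->
     (vord (c i) (phi x) <= vord (c i) (phi y))%N) ->
  exists s w, s \notin p /\ s * y = x * w.
Proof.
move=> x0 y0 le; have [hd hf hdiv] := hc.
have phi0 (z : S) : z != 0 -> phi z != 0.
  by apply: contra_neq => /(_ =P _); rewrite -(rmorph0 phi) => /eqP/phi_inj.
have /finite_seqP[r er] := hf _ (phi0 _ x0).
have inr i : phi x \in c i -> i \in r.
  by move=> xi; have : [set` r]%classic i by rewrite -er.
have /choice[t ht] : forall i, exists t : S, t \notin p /\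
    (~ {subset contraction phi (c i) <= p} -> phi t \in c i).
  move=> i; have [sub|nsub] := pselect {subset contraction phi (c i) <= p}.
    by exists 1; split=> //; exact: prime1.
  by have /existsNP[t /not_implyP[t1 /negP t2]] := nsub; exists t.
pose s := \prod_(i <- r) t i ^+ vord (c i) (phi x).
have sp : s \notin p.
  apply: prime_prod => // i _; rewrite primeX // negb_and.
  by have [-> _] := ht i; rewrite orbT.
have s0 : s != 0 := notin_prime_neq0 hp sp.
have [|z] := hdiv _ _ (phi0 _ x0) (phi0 _ (mulf_neq0 s0 y0)); last first.
  by move=> /(phi_div x0)[w e]; exists s, w.
move=> i.
have [sub|nsub] := pselect {subset contraction phi (c i) <= p}.
  rewrite rmorphM vordM ?phi0 //; apply: leq_trans (le _ sub) _;
    exact: leq_addl.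
have [xi|xi] := boolP (phi x \in c i); last by rewrite vord_notin.
have ti0 : t i != 0 by have [/(notin_prime_neq0 hp)] := ht i.
apply: leq_trans (_ : (vord (c i) (phi (t i ^+ vord (c i) (phi x))) <= _)%N).
  rewrite rmorphXn vordX ?phi0 // -[leqLHS]muln1 leq_mul2l vord_gt0 ?phi0 //.
  by have [_ /(_ nsub)->] := ht i; rewrite orbT.
have : s = t i ^+ vord (c i) (phi x) * \prod_(j <- rem i r) t j ^+ vord (c j)
  (phi x).
  by rewrite /s (perm_big _ (perm_to_rem (inr _ xi))) big_cons.
move=> es; move: s0; rewrite {1}es mulf_eq0 negb_or => /andP[u0 v0].
rewrite {}es -mulrA rmorphM (vordM (hd i) (phi0 _ u0)) ?leq_addr //.
by rewrite phi0 // mulf_neq0.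
Qed.

(** If no member of the family qualified, [local_div] would divide 1 by [x] locally at [p], although
    [x] lies in [p]. *)
Lemma contraction_sub_prime x : x \in p -> x != 0 ->
  exists i, phi x \in c i /\ {subset contraction phi (c i) <= p}.
Proof.
move=> xp x0; apply: contrapT => /forallNP H.
have [||i sub|s [w [sp e]]] := @local_div x 1; rewrite ?oner_eq0 //.
  have [hd _ _] := hc; have [xi|xi] := boolP (phi x \in c i);
    last by rewrite vord_notin.
  by case: (H i).
by move: sp; rewrite -[s]mulr1 e primeMr.
Qed.
End LocalDivision.

Section FamilyKrull.
Variables (R : idomainType) (I : eqType) (c : I -> {pred R}).
Hypothesis hc : dvr_family c.

Lemma family_height1 (P : height1 R) : exists i, c i =i P.
Proof.
have [x xP x0] := height1_neq0 P.
have idD (u v w : R) : u != 0 -> idfun v = idfun u * w -> exists z, v = u * z.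
  by move=> _ e; exists w.
have [i [xi sub]] :=
  contraction_sub_prime
    (phi := idfun) (fun _ _ e => e) idD hc (height1_prime P) xP x0.
have hd : forall i, dvr (c i) by have [] := hc.
exists i => y; apply/idP/idP; first exact: sub.
exact: (height1_minimal (dvr_prime (hd i)) xi x0 sub).
Qed.

Lemma dvr_eqi (P Q : {pred R}) : P =i Q -> dvr P -> dvr Q.
Proof.
move=> PQ; suff -> : P = Q by [].
by apply/funext => y; exact: PQ.
Qed.

Lemma family_krull : krull R.
Proof.
have [hd hf hdiv] := hc; split.
- by move=> P; have [i /dvr_eqi] := family_height1 P; apply.
- move=> x x0; have := finite_image (fun i => height1_of (hd i)) (hf _ x0).
  apply: sub_finite_set => P /= xP.
  have [i iP] := family_height1 P; exists i => /=; first by rewrite iP.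
  exact: height1_eq.
- by move=> x y x0 y0 le; apply: hdiv => // i; apply: (le (height1_of (hd i))).
Qed.
End FamilyKrull.

(** * Polynomials over a Krull domain *)

Lemma fractionP (T : idomainType) (x : {fraction T}) :
  exists a b : T, b != 0 /\ x = tofrac a / tofrac b.
Proof.
elim/quotW: x => r; exists r.1, r.2; have r0 := denom_ratioP r.
split=> //; apply: (canRL (mulfK _)); first by rewrite tofrac_eq0.
unlock FracField.tofrac; rewrite -[LHS]FracField.pi_mul.
apply/eqmodP; rewrite /= FracField.equivfE /FracField.mulf /=.
by rewrite !numden_Ratio ?(oner_neq0, mulf_neq0, mulr1) // mulrC.
Qed.

Section Content.
Variables (T : idomainType) (p : {pred T}) (hp : dvr p).
Let pp := dvr_prime hp.

(** Here [k] is the least value of a nonzero member of [xs], and [s] is the product of the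
    denominators of the individual divisions by [unif p ^+ k]; a member attaining [k] gets a
    cofactor outside [p]. *)
Lemma content_split (xs : seq T) : (exists2 x, x \in xs & x != 0) ->
  exists s k, [/\ s \notin p,
     forall x, x \in xs -> exists r, s * x = unif p ^+ k * r
   & exists x r, [/\ x \in xs, r \notin p & s * x = unif p ^+ k * r]].
Proof.
have [_ _ u0 _] := unifP hp.
case=> x xxs x0.
have exk : exists k, has (fun y => (y != 0) && (vord p y == k)) xs.
  by exists (vord p x); apply/hasP; exists x => //; rewrite x0 eqxx.
case: (ex_minnP exk) => k /hasP[y yxs /andP[y0 /eqP vy]] mink.
have vu : vord p (unif p ^+ k) = k by rewrite vordX // vord_at ?muln1 //;
  apply: unifP.
have /choice[t ht] : forall z, exists t, t \notin p /\
    (z \in xs -> exists r, t * z = unif p ^+ k * r).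
  move=> z; have [zxs|_] := boolP (z \in xs); last by exists 1; split;
    rewrite ?prime1.
  have [->|z0] := eqVneq z 0.
    by exists 1; split; rewrite ?prime1 // => _; exists 0; rewrite !mulr0.
  have [|s [r [sp e]]] := (vord_leP hp (expf_neq0 k u0) z0).1.
    by rewrite vu; apply: mink; apply/hasP; exists z => //; rewrite z0 eqxx.
  by exists s; split=> // _; exists r.
pose s := \prod_(z <- xs) t z.
have sp : s \notin p by apply: prime_prod => // z _; have [] := ht z.
have hs z : z \in xs -> exists r, s * z = unif p ^+ k * r.
  move=> zxs; have [_ /(_ zxs)[r e]] := ht z.
  exists ((\prod_(w <- rem z xs) t w) * r).
  rewrite /s (perm_big _ (perm_to_rem zxs)) big_cons /=.
  by rewrite mulrAC e; mulAC.
exists s, k; split=> //; have [r e] := hs _ yxs; exists y, r; split=> //.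
have s0 := notin_prime_neq0 pp sp.
have r0 : r != 0.
  by apply: contraTneq (mulf_neq0 s0 y0) => r0; rewrite e r0 mulr0 eqxx.
move/(congr1 (vord p)): e;
  rewrite !vordM ?expf_neq0 // vu vy (vord_notin hp sp) add0n.
by rewrite -vord_eq0 // => /eqP; rewrite -{1}[k]addn0 eqn_add2l eq_sym.
Qed.
End Content.

Section GaussPoly.
Variables (T : idomainType) (p : {pred T}) (hp : dvr p).
Let pp := dvr_prime hp.
Implicit Types f : {poly T}.

(** The extension pT[X] of [p]; its valuation is the Gauss valuation, the least value of a nonzero
    coefficient. *)
Definition gauss : {pred {poly T}} := fun f => `[< forall i, f`_i \in p >].

Lemma gaussP f : reflect (forall i, f`_i \in p) (f \in gauss).
Proof. exact: asboolP. Qed.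

Lemma gaussC c : (c%:P \in gauss) = (c \in p).
Proof.
apply/gaussP/idP => [/(_ 0%N)|cp i]; rewrite coefC //.
by case: eqP => // _; exact: prime0.
Qed.

Lemma gauss_notin f : f \notin gauss ->
  exists i, f`_i \notin p /\ forall j, (j < i)%N -> f`_j \in p.
Proof.
move=> /gaussP/existsNP[i /negP hi].
case: (ex_minnP (ex_intro (fun i => f`_i \notin p) i hi)) => j hj minj.
by exists j; split=> // k; apply: contraTT => /minj; rewrite -leqNgt.
Qed.

Lemma gauss_prime : prime_ideal gauss.
Proof.
split; first split.
- by apply/gaussP => i; rewrite coef0; exact: prime0.
- by rewrite gaussC; exact: prime1.
- move=> a u v /gaussP hu /gaussP hv; apply/gaussP => i.
  rewrite coefD coefM primeD // prime_sum // => j _; exact: primeMl.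
move=> u v; apply: contraLR; rewrite negb_or.
move=> /andP[/gauss_notin[i [ui mi]] /gauss_notin[j [vj mj]]].
apply/gaussP => /(_ (i + j)%N); apply/negP.
have ij : (i < (i + j).+1)%N by rewrite ltnS leq_addr.
rewrite coefM (bigD1 (Ordinal ij)) //= addKn;
  apply: contra (_ : u`_i * v`_j \notin p).
  rewrite -[X in _ -> is_true (X \in p)](addrK (\sum_(k < (i + j).+1 | k !=
    Ordinal ij) u`_k * v`_(i + j - k))).
  move=> h; apply: primeB => //; apply: prime_sum => // k nk.
  have : (k : nat) != i by apply: contraNneq nk => e; apply/eqP/val_inj.
  rewrite neq_ltn => /orP[/mi|lt]; first exact: primeMr.
  by apply: primeMl => //; apply: mj; rewrite ltn_subLR ?ltn_add2r // -ltnS.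
by rewrite primeM // negb_or ui.
Qed.

Lemma gauss_is_ord f : f != 0 -> exists k s r,
  [/\ s \notin p, r \notin gauss, s%:P * f = (unif p)%:P ^+ k * r
    & forall i, f`_i != 0 -> (k <= vord p f`_i)%N].
Proof.
move=> f0; have [|s [k [sp hs [x [r [xf rp e]]]]]] :=
  content_split hp (xs := f).
  by exists (lead_coef f);
    rewrite ?lead_coef_eq0 // mem_nth // prednK ?lt0n ?size_poly_eq0.
have [_ _ u0 _] := unifP hp.
have /choice[t ht] : forall i, exists r, s * f`_i = unif p ^+ k * r.
  move=> i; have [lt|ge] := ltnP i (size f); first exact/hs/mem_nth.
  by exists 0; rewrite nth_default ?mulr0.
pose g := \poly_(i < size f) t i.
have eg : s%:P * f = (unif p)%:P ^+ k * g.
  apply/polyP => i; rewrite -polyC_exp !coefCM coef_poly.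
  by case: ltnP => [_|ge]; rewrite // nth_default // !mulr0.
exists k, s, g; split=> //; last first.
  move=> i fi; have -> : k = vord p (unif p ^+ k).
    by rewrite vordX // vord_at ?muln1 //; apply: unifP.
  by apply/(vord_leP hp (expf_neq0 k u0) fi); exists s, (t i); split.
have [i lti xi] := nthP 0 xf.
apply: contra rp => /gaussP/(_ i); rewrite coef_poly lti.
suff -> : t i = r by [].
by apply: (mulfI (expf_neq0 k u0)); rewrite -ht xi.
Qed.

Lemma gauss_dvr_at : dvr_at gauss (unif p)%:P.
Proof.
have [_ pu u0 _] := unifP hp.
split; rewrite ?gaussC ?polyC_eq0 //; first exact: gauss_prime.
move=> f /gauss_is_ord[k [s [r [sp rp e _]]]].
by exists k, s%:P, r; rewrite gaussC.
Qed.

Lemma gauss_dvr : dvr gauss. Proof. by exists (unif p)%:P;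
  exact: gauss_dvr_at. Qed.

Lemma vord_gauss_coef f i : f`_i != 0 -> (vord gauss f <= vord p f`_i)%N.
Proof.
move=> fi; have f0 : f != 0 by apply: contra_neq fi => ->; rewrite coef0.
have [k [s [r [sp rp e /(_ i fi)]]]] := gauss_is_ord f0.
suff -> : vord gauss f = k by [].
by apply: (vord_dvr_at gauss_dvr gauss_dvr_at) => //; exists s%:P, r;
  rewrite gaussC.
Qed.

Lemma vord_gaussC c : c != 0 -> vord gauss c%:P = vord p c.
Proof.
move=> c0; apply: (vord_dvr_at gauss_dvr gauss_dvr_at); rewrite ?polyC_eq0 //.
have [s [r [sp rp e]]] := vordP hp c0.
by exists s%:P, r%:P; rewrite !gaussC -polyCM e polyCM polyC_exp.
Qed.

End GaussPoly.

(** * Irreducible factors of polynomials over a field *)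

Section IrredPoly.
Variable F : fieldType.
Implicit Types f g h : {poly F}.

Lemma irredp_coprime g f : irreducible_poly g -> ~~ (g %| f) -> coprimep g f.
Proof. by move=> hg; rewrite irreducible_poly_coprime. Qed.

Lemma irredp_dvdM g f h : irreducible_poly g ->
  (g %| f * h) = (g %| f) || (g %| h).
Proof.
move=> hg; apply/idP/orP => [|[]]; [|exact: dvdp_mulr|exact: dvdp_mull].
have [_ _|ngf] := boolP (g %| f); first by left.
by rewrite Gauss_dvdpr ?irredp_coprime //; right.
Qed.

Lemma size_mul_gt g h : (1 < size g)%N -> h != 0 -> (size h < size (h * g)%R)%N.
Proof.
move=> g1 h0; have g0 : g != 0 by rewrite -size_poly_gt0 ltnW.
rewrite size_mul //; case: (size g) g1 => [|[|k]] // _.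
by rewrite addnS /= addnS ltnS leq_addr.
Qed.

Lemma irredp_factor f : (1 < size f)%N ->
  exists g, [/\ g \is monic, irreducible_poly g & g %| f].
Proof.
move=> f1.
have exk : exists k, `[< exists g, [/\ (1 < size g)%N, size g = k & g %| f] >].
  by exists (size f); apply/asboolP; exists f.
case: (ex_minnP exk) => k /asboolP[g [g1 gk gf]] mink.
have g0 : g != 0 by rewrite -size_poly_gt0 ltnW.
have lg : (lead_coef g)^-1 != 0 by rewrite invr_eq0 lead_coef_eq0.
exists ((lead_coef g)^-1 *: g); split.
- by rewrite monicE lead_coefZ mulVf // lead_coef_eq0.
- split; first by rewrite size_scale.
  move=> q q1; rewrite dvdpZr // => qg.
  have q0 : q != 0 by apply: contra_neq g0 => q0; move: qg;
    rewrite q0 dvd0p => /eqP.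
  have q2 : (1 < size q)%N by rewrite ltn_neqAle eq_sym q1 size_poly_gt0.
  rewrite eqp_sym (eqp_ltrans (eqp_scale _ lg)) eqp_sym -dvdp_size_eqp //.
  rewrite eqn_leq (dvdp_leq g0 qg) gk; apply: mink; apply/asboolP.
  by exists q; split=> //; apply: dvdp_trans gf.
- by rewrite dvdpZl.
Qed.

Lemma multiplicity g f : irreducible_poly g -> f != 0 ->
  exists k h, f = g ^+ k * h /\ ~~ (g %| h).
Proof.
move=> hg; have [m] := ubnP (size f); elim: m f => // m IH f fm f0.
have [/dvdpP[h e]|nd] := boolP (g %| f); last by exists 0%N, f; rewrite mul1r.
have h0 : h != 0 by apply: contra_neq f0 => h0; rewrite e h0 mul0r.
have [|k [h' [eh nd]]] := IH h _ h0.
  apply: leq_trans (_ : (size f <= m)%N); last by [].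
  by rewrite e size_mul_gt //; apply: hg.1.
by exists k.+1, h'; rewrite e eh exprS mulrC mulrA.
Qed.

(** The factors [s] and [r] are coprime to [g], and [h] is a nonzero constant that stems from
    clearing denominators; so [j] is the multiplicity of [g] in [f]. *)
Lemma irredp_exp_dvd g j s h r f : irreducible_poly g -> ~~ (g %| s) ->
  ~~ (g %| r) ->
  s * f = h * (g ^+ j * r) -> size h = 1%N ->
    forall k, (g ^+ k %| f) = (k <= j)%N.
Proof.
move=> hg gs gr e h1 k.
have -> : (g ^+ k %| f) = (g ^+ k %| s * f).
  by rewrite Gauss_dvdpr // coprimep_expl // irredp_coprime.
have /size_poly1P[c c0 eh] : size h == 1%N by apply/eqP.
rewrite e eh.
rewrite mul_polyC dvdpZr // Gauss_dvdpl ?coprimep_expl ?irredp_coprime //.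
by rewrite dvdp_Pexp2l ?hg.1.
Qed.

Lemma irredp_dvd f g : f != 0 ->
  (forall h k, h \is monic -> irreducible_poly h -> h ^+ k %| f ->
    h ^+ k %| g) -> f %| g.
Proof.
have [m] := ubnP (size f); elim: m f g => // m IH f g fm f0 hfg.
have [f1|f1] := leqP (size f) 1.
  have : size f == 1%N by rewrite eqn_leq f1 size_poly_gt0.
  by rewrite size_poly_eq1 => /eqp_dvdl->; apply: dvd1p.
have [h [hm hi /dvdpP[f' ef]]] := irredp_factor f1.
have /dvdpP[g' eg] : h %| g by have := hfg h 1%N hm hi; rewrite expr1; apply;
  rewrite ef dvdp_mull.
have h0 := irredp_neq0 hi.
have f'0 : f' != 0 by apply: contra_neq f0 => e; rewrite ef e mul0r.
rewrite ef eg dvdp_mul2r //; apply: IH => //.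
  apply: leq_trans (_ : (size f <= m)%N); last by [].
  by rewrite ef size_mul_gt //; apply: hi.1.
move=> q k qm qi qf.
have [eqh|nqh] := eqVneq q h.
  have := hfg q k.+1 qm qi; rewrite eqh ef eg exprSr !dvdp_mul2r //.
  by apply; rewrite -eqh.
have cop : coprimep (q ^+ k) h.
  rewrite coprimep_expl // irredp_coprime //; apply: contra nqh => qh.
  rewrite -eqp_monic //; apply: hi.2 => //.
  by rewrite gtn_eqF ?qi.1.
have := hfg q k qm qi; by rewrite eg ef !Gauss_dvdpl //; apply.
Qed.

Lemma irredp_finite f : f != 0 -> exists r : seq {poly F}, forall g,
  g \is monic -> irreducible_poly g -> g %| f -> g \in r.
Proof.
have [m] := ubnP (size f); elim: m f => // m IH f fm f0.
have [f1|f1] := leqP (size f) 1.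
  exists [::] => g _ [g1 _] /(dvdp_leq f0) gf.
  by move: (leq_trans g1 (leq_trans gf f1)); rewrite ltnn.
have [h [hm hi /dvdpP[f' ef]]] := irredp_factor f1.
have f'0 : f' != 0 by apply: contra_neq f0 => e; rewrite ef e mul0r.
have [|r hr] := IH f' _ f'0.
  apply: leq_trans (_ : (size f <= m)%N); last by [].
  by rewrite ef size_mul_gt //; apply: hi.1.
exists (h :: r) => g gm gi; rewrite ef irredp_dvdM // inE => /orP[gf'|gh].
  by rewrite hr ?orbT.
rewrite -eqp_monic //; apply/orP; left; apply: hi.2 => //.
by rewrite gtn_eqF ?gi.1.
Qed.

End IrredPoly.

Section PolyKrull.
Variable T : idomainType.
Variables (F : fieldType) (iota : {rmorphism T -> F}).
Local Notation lift := (map_poly iota).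
Implicit Types (f : {poly T}) (g h : {poly F}).
Hypothesis iota_inj : injective iota.
Hypothesis iota_frac : forall x, exists a b : T, b != 0 /\ x = iota a / iota b.

Let iota_eq0 x : (iota x == 0) = (x == 0).
Proof. by rewrite -(rmorph0 iota) (inj_eq iota_inj). Qed.

Let lift_inj : injective lift. Proof. exact: (map_inj_poly iota_inj (rmorph0
  iota)). Qed.

Let lift0 f : f != 0 -> lift f != 0.
Proof. by apply: contra_neq => e; apply: lift_inj; rewrite e rmorph0. Qed.

Lemma clear_denominators h :
  exists (d : T) (f : {poly T}), d != 0 /\ lift f = (iota d)%:P * h.
Proof.
elim/poly_ind: h => [|h c [d [f [d0 ef]]]].
  by exists 1, 0; rewrite oner_eq0 rmorph0 mulr0.
have [a [b [b0 ec]]] := iota_frac c.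
have ib : iota b != 0 by rewrite iota_eq0.
exists (d * b), (b%:P * f * 'X + (d * a)%:P); split; first by rewrite mulf_neq0.
rewrite rmorphD !rmorphM /= !map_polyC map_polyX /= ef ec mulrDr; congr (_ + _).
  by mulAC.
rewrite -!polyCM -mulrA; congr ((_ * _)%:P).
by rewrite mulrCA mulfV ?mulr1.
Qed.

(** The contraction to T[X] of the ideal generated by [g] in F[X]. *)
Definition lift_dvd g : {pred {poly T}} := fun f => g %| lift f.

Lemma lift_dvdE g f : (f \in lift_dvd g) = (g %| lift f). Proof. by []. Qed.

Section Irred.
Variables (g : {poly F}) (hg : irreducible_poly g).

Let const_notin (d : T) : d != 0 -> d%:P \notin lift_dvd g.
Proof.
move=> d0; rewrite lift_dvdE map_polyC /=; apply/negP => /dvdp_leq.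
rewrite polyC_eq0 iota_eq0 => /(_ d0); rewrite size_polyC iota_eq0 d0.
by rewrite leqNgt hg.1.
Qed.

Lemma lift_dvd_prime : prime_ideal (lift_dvd g).
Proof.
split; first split.
- by rewrite lift_dvdE rmorph0 dvdp0.
- by rewrite -polyC1; apply: const_notin; exact: oner_neq0.
- by move=> a u v; rewrite !lift_dvdE rmorphD rmorphM => gu gv;
    rewrite dvdp_add // dvdp_mull.
- by move=> u v; rewrite !lift_dvdE rmorphM irredp_dvdM.
Qed.

(** Nonzero constants of [T] lie outside the prime, so denominators can be cleared freely, and a
    multiple of [g] with coefficients in [T] is a uniformizer. *)
Lemma lift_dvd_dvr : exists pi e, [/\ dvr_at (lift_dvd g) pi, e != 0
  & lift pi = e%:P * g].
Proof.
have [d [pi [d0 epi]]] := clear_denominators g.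
have id0 : iota d != 0 by rewrite iota_eq0.
have g0 := irredp_neq0 hg.
exists pi, (iota d); split=> //; split.
- exact: lift_dvd_prime.
- by rewrite lift_dvdE epi dvdp_mull.
- apply: contraTneq (mulf_neq0 (_ : (iota d)%:P != 0) g0) => [e|];
    last by rewrite polyC_eq0.
  by rewrite -epi e rmorph0 eqxx.
move=> f /lift0 f0; have [k [h [ef nh]]] := multiplicity hg f0.
have [a [r [a0 er]]] := clear_denominators h.
have ia0 : iota a != 0 by rewrite iota_eq0.
exists k, ((d ^+ k * a)%:P), r; split.
- by rewrite const_notin // mulf_neq0 ?expf_neq0.
- by rewrite lift_dvdE er mul_polyC dvdpZr.
rewrite polyCM polyC_exp; apply: lift_inj.
rewrite !rmorphM !rmorphXn /= !map_polyC /= ef er epi exprMn; mulAC.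
Qed.

Lemma lift_dvd_vord f k : f != 0 ->
  (g ^+ k %| lift f) = (k <= vord (lift_dvd g) f)%N.
Proof.
move=> f0; have [pi [e [hpi e0 epi]]] := lift_dvd_dvr.
have hd : dvr (lift_dvd g) by exists pi.
have [_ _ _ /(_ f f0)[j hj]] := hpi.
rewrite (vord_dvr_at hd hpi f0 hj); have [s [r [sg rg es]]] := hj.
apply: (irredp_exp_dvd hg (s := lift s) (r := lift r) (h := (e ^+ j)%:P)) => //.
  by rewrite -rmorphM es rmorphM rmorphXn /= epi exprMn polyC_exp mulrA.
by rewrite size_polyC expf_neq0.
Qed.

End Irred.

Definition irred_poly := {g : {poly F} | (g \is monic) && `[< irreducible_poly
  g >]}.

Lemma irred_polyP (g : irred_poly) : val g \is monic /\
  irreducible_poly (val g).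
Proof. by have /andP[? /asboolP ?] := valP g. Qed.

Definition poly_primes (i : height1 T + irred_poly) : {pred {poly T}} :=
  match i with inl p => gauss p | inr g => lift_dvd (val g) end.

Lemma fraction_poly_krull : krull T -> krull {poly T}.
Proof.
move=> [hd hf hdiv]; apply: (@family_krull _ _ poly_primes); split.
- case=> [p|g] /=; first exact/gauss_dvr/hd.
  by have [pi [_ [hpi _ _]]] := lift_dvd_dvr (irred_polyP g).2; exists pi.
- move=> f f0.
  have [i fi] : exists i, f`_i != 0.
    by exists (size f).-1; rewrite -lead_coefE lead_coef_eq0.
  have [r hr] := irredp_finite (lift0 f0).
  pose primes1 : set (height1 T + irred_poly) :=
    (inl @` [set p : height1 T | f`_i \in p])%classic.
  pose primes2 : set (height1 T + irred_poly) :=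
    (inr @` [set` pmap insub r : seq irred_poly])%classic.
  have : finite_set (primes1 `|` primes2)%classic.
    by rewrite finite_setU; split; apply: finite_image => //; apply: hf.
  apply: sub_finite_set.
  case=> [p|g] /=.
    by move=> /gaussP/(_ i) hp; left; exists p.
  move=> gf; right; exists g => //=; rewrite mem_pmap_sub.
  by have [gm gi] := irred_polyP g; apply: hr.
- move=> x y x0 y0 le.
  (* The primes contracted from F[X] give divisibility over [F]. After clearing denominators, a y =
     x z; the Gauss valuations then bound the values of the coefficients of [z] below by those of
     [a], so [a] divides each coefficient in [T]. *)
  have /dvdpP[q eq] : lift x %| lift y.
    apply: irredp_dvd (lift0 x0) _ => g k gm gi.
    have hg : (g \is monic) && `[< irreducible_poly g >] by rewrite gm;
      apply/asboolP.
    rewrite !lift_dvd_vord // => /leq_trans; apply.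
    exact: (le (inr (exist _ g hg))).
  have [a [z [a0 ez]]] := clear_denominators q.
  have ia0 : iota a != 0 by rewrite iota_eq0.
  have e : a%:P * y = x * z.
    by apply: lift_inj; rewrite !rmorphM /= map_polyC /= eq ez; mulAC.
  have ca0 : a%:P != 0 by rewrite polyC_eq0.
  have z0 : z != 0 by apply: contraTneq (mulf_neq0 ca0 y0) => z0;
    rewrite e z0 mulr0 eqxx.
  have /choice[t ht] : forall i, exists t, z`_i = a * t.
    move=> i; have [->|zi] := eqVneq z`_i 0; first by exists 0; rewrite mulr0.
    apply: hdiv => // p; have hp := hd p; have hgp := gauss_dvr hp.
    apply: leq_trans (vord_gauss_coef hp zi).
    move/(congr1 (vord (gauss p))): e; rewrite !vordM // vord_gaussC //.
    move=> e; rewrite -(leq_add2r (vord (gauss p) y)) e addnC leq_add2l.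
    exact: (le (inl p)).
  exists (\poly_(i < size z) t i); apply: (mulfI ca0).
  rewrite e mulrCA; congr (_ * _); apply/polyP => i; rewrite coefCM coef_poly.
  by case: ltnP => ?; rewrite // nth_default // mulr0.
Qed.

End PolyKrull.

Lemma poly_krull (T : idomainType) : krull T -> krull {poly T}.
Proof.
apply: (@fraction_poly_krull _ _ (@tofrac T)); last exact: fractionP.
by move=> x y /eqP; rewrite tofrac_eq => /eqP.
Qed.

(** * Transport along ring isomorphisms, and passage to several variables *)

Section Transport.
Variables (T U : idomainType) (sigma : {rmorphism T -> U}) (tau : U -> T).
Hypotheses (sigmaK : cancel sigma tau) (tauK : cancel tau sigma).
Variables (P : {pred U}) (hP : dvr P).

Let cP := contraction sigma P.

Let cPE x : (x \in cP) = (sigma x \in P). Proof. by []. Qed.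

Let tau_eq0 x : (tau x == 0) = (x == 0).
Proof. by rewrite -(inj_eq (can_inj sigmaK)) tauK rmorph0. Qed.

Lemma contraction_prime (Q : {pred U}) : prime_ideal Q ->
  prime_ideal (contraction sigma Q).
Proof.
move=> hQ; split; first split.
- by rewrite contractionE rmorph0; apply: prime0.
- by rewrite contractionE rmorph1; apply: prime1.
- by move=> a u v; rewrite !contractionE rmorphD rmorphM => Qu Qv;
    rewrite primeD // primeMl.
- by move=> u v; rewrite !contractionE rmorphM primeM.
Qed.

Let is_ord_iso x k : is_ord P (unif P) (sigma x) k ->
  is_ord cP (tau (unif P)) x k.
Proof.
move=> [s [r [sP rP e]]]; exists (tau s), (tau r); rewrite !cPE !tauK;
  split=> //.
by apply: (can_inj sigmaK); rewrite !rmorphM rmorphXn /= !tauK.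
Qed.

Let dvr_at_iso : dvr_at cP (tau (unif P)).
Proof.
have [pP uP u0 hx] := unifP hP.
split; rewrite ?cPE ?tauK ?tau_eq0 //; first exact: contraction_prime.
move=> x x0; have [|k /is_ord_iso hk] := hx (sigma x); last by exists k.
by rewrite -(inj_eq (can_inj sigmaK)) rmorph0 in x0.
Qed.

Lemma dvr_iso : dvr cP. Proof. by exists (tau (unif P)); exact: dvr_at_iso. Qed.

Lemma vord_iso x : x != 0 -> vord cP x = vord P (sigma x).
Proof.
move=> x0; apply: (vord_dvr_at dvr_iso dvr_at_iso x0);
  apply/is_ord_iso/vordP => //.
by rewrite -(inj_eq (can_inj sigmaK)) rmorph0 in x0.
Qed.
End Transport.

Lemma krull_iso (T U : idomainType) (sigma : {rmorphism T -> U})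
    (tau : U -> T) :
  cancel sigma tau -> cancel tau sigma -> krull U -> krull T.
Proof.
move=> sigmaK tauK [hd hf hdiv].
have s0 x : x != 0 -> sigma x != 0.
  by apply: contra_neq => e; apply: (can_inj sigmaK); rewrite e rmorph0.
apply: (@family_krull _ _ (fun P : height1 U => contraction sigma P)); split.
- by move=> P; apply: (dvr_iso sigmaK tauK (hd P)).
- by move=> x x0; apply: (hf (sigma x)); apply: s0.
- move=> x y x0 y0 le; have [|z e] := hdiv _ _ (s0 _ x0) (s0 _ y0).
    by move=> P; rewrite -!(vord_iso sigmaK tauK (hd P)).
  by exists (tau z); apply: (can_inj sigmaK); rewrite rmorphM tauK.
Qed.

Lemma mpoly_rmorph_eq (R : comNzRingType) (S : comNzRingType) n (f g :
  {rmorphism {mpoly R[n]} -> S}) :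
  (forall c, f c%:MP = g c%:MP) -> (forall i, f 'X_i = g 'X_i) -> f =1 g.
Proof.
move=> fgC fgX p; rewrite (mpolyE p) !rmorph_sum; apply: eq_bigr => m _.
rewrite -mul_mpolyC !rmorphM fgC mpolyXE_id !rmorph_prod; congr (_ * _).
by apply: eq_bigr => i _; rewrite !rmorphXn fgX.
Qed.

Section MpolyIso.
Variables (R : idomainType) (n : nat).

Definition muni_inv : {poly {mpoly R[n]}} -> {mpoly R[n.+1]} :=
  horner_eval 'X_ord_max \o map_poly (@mwiden n R).

HB.instance Definition _ := GRing.RMorphism.on muni_inv.

Lemma muniX (i : 'I_n) : @muni n R 'X_(widen_ord (leqnSn n) i) = ('X_i)%:P.
Proof.
rewrite muniE msuppX big_seq1 mcoeffX eqxx scale1r mnm1E.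
have /negbTE-> : widen_ord (leqnSn n) i != ord_max.
  by rewrite -val_eqE /= neq_ltn ltn_ord.
rewrite expr0 alg_polyC; congr (_%:P); congr 'X_[_].
by apply/mnmP => j; rewrite mnmE !mnm1E -!val_eqE.
Qed.

Lemma muniXmax : @muni n R 'X_ord_max = 'X.
Proof.
rewrite muniE msuppX big_seq1 mcoeffX eqxx scale1r mnm1E eqxx expr1.
rewrite (_ : [multinom _ | i < n] = 0%MM) ?mpolyX0 ?scale1r //.
apply/mnmP => j; rewrite mnmE mnm1E mnm0E -val_eqE /= gtn_eqF //.
Qed.

Lemma muniK : cancel (@muni n R) muni_inv.
Proof.
move=> p; apply: (mpoly_rmorph_eq (f := muni_inv \o @muni n R)
    (g := idfun)) => [c|i] /=.
  by rewrite muniC /muni_inv /= map_polyC /= /horner_eval hornerC mwidenC.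
have [j ->|->] := unliftP ord_max i; last first.
  by rewrite muniXmax /muni_inv /= map_polyX /horner_eval hornerX.
have -> : fintype.lift ord_max j = widen_ord (leqnSn n) j.
  by apply: val_inj; rewrite /= /bump leqNgt ltn_ord.
by rewrite muniX /muni_inv /= map_polyC /= /horner_eval hornerC mwidenX
  mnmwiden1.
Qed.

Lemma muni_invK : cancel muni_inv (@muni n R).
Proof.
elim/poly_ind => [|p c IH]; first by rewrite !rmorph0.
rewrite !rmorphD !rmorphM /= IH; congr (_ * _ + _).
  by rewrite /muni_inv /= map_polyX /horner_eval hornerX muniXmax.
rewrite /muni_inv /= map_polyC /= /horner_eval hornerC.
apply: (mpoly_rmorph_eq (f := @muni n R \o @mwiden n R)
    (g := polyC)) => [d|i] /=.
  by rewrite mwidenC muniC.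
by rewrite mwidenX mnmwiden1 muniX.
Qed.

End MpolyIso.

Lemma mpoly_krull (T : idomainType) n : krull T -> krull {mpoly T[n]}.
Proof.
move=> hT; elim: n => [|n IH]; last first.
  exact: krull_iso (@muniK T n) (@muni_invK T n) (poly_krull IH).
apply: (krull_iso (sigma := mcoeff 0%MM) (tau := @mpolyC 0 T)) hT => [p|c].
  apply/mpolyP => m; rewrite /= mcoeffC (_ : m = 0%MM) ?eqxx ?mulr1 //.
  by apply/mnmP => -[].
by rewrite /= mcoeffC eqxx mulr1.
Qed.

(** * Integral closures with finite residue rings *)

(** Finiteness of A/aA, expressed by a map to a finite type that separates the residue classes. *)
Definition finite_residue (A : idomainType) (a : A) :=
  exists (X : finType) (r : A -> X),
    forall x y, r x = r y -> exists z, x - y = a * z.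

Lemma pigeonhole_fiber (J X : finType) (r : J -> X) N :
  (#|X| * N < #|J|)%N -> exists x, (N < #|[pred j | r j == x]|)%N.
Proof.
move=> lt; apply: contrapT => /forallNP H; move: lt; rewrite ltnNge => /negP;
  apply.
rewrite -sum1_card (partition_big r xpredT) //= -sum_nat_const.
by apply: leq_sum => x _; rewrite sum1_card leqNgt; apply/negP/H.
Qed.

(** By the bound there is a largest family of pairwise incongruent elements; every element is
    congruent to a member of it, and the index of such a member serves as the separating map. *)
Lemma finite_residue_bound (A : idomainType) (a : A) N :
  (forall (J : finType) (u : J -> A), (N < #|J|)%N ->
     exists i j, i != j /\ exists z, u i - u j = a * z) ->
  finite_residue a.
Proof.
move=> bnd.
pose P n := `[< exists u : 'I_n -> A, forall i j, i != j ->
  ~ exists z, u i - u j = a * z >].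
have P0 : exists n, P n.
  by exists 0%N; apply/asboolP; exists (fun i => 0) => -[].
have Pb n : P n -> (n <= N)%N.
  move=> /asboolP[u hu]; rewrite leqNgt; apply/negP => lt.
  by have [|i [j [ij e]]] := bnd _ u; rewrite ?card_ord // ; apply: (hu i j).
case: (ex_maxnP P0 Pb) => n /asboolP[u hu] maxn.
have /choice[f hf] : forall x, exists i, exists z, x - u i = a * z.
  move=> x; apply: contrapT => /forallNP nx.
  suff /maxn : P n.+1 by rewrite ltnn.
  apply/asboolP; exists
    (fun i => if unlift ord_max i is Some j then u j else x).
  move=> i j; case: unliftP => [i' ->|->]; case: unliftP => [j' ->|->].
  - by move=> ij; apply: hu; apply: contra_neq ij => ->.
  - by move=> _ [z e]; apply: (nx i'); exists (- z); rewrite mulrN -e opprB.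
  - by move=> _; apply: nx.
  - by rewrite eqxx.
exists 'I_n, f => x y fxy; have [z e] := hf x; have [z' e'] := hf y.
by exists (z - z'); rewrite mulrBr -e -e' fxy opprB subrKA.
Qed.

Section Lattices.
Variables (B : idomainType) (K0 : fieldType) (iota : {rmorphism B -> K0}).
Hypothesis iota_inj : injective iota.
Hypothesis iota_frac : forall x : K0, exists a b : B,
  b != 0 /\ x = iota a / iota b.
Hypothesis bezout : forall m n : B, exists s t u v,
  m = u * (s * m + t * n) /\ n = v * (s * m + t * n).

Lemma bezout_frac (x y : K0) : exists s t u v : B,
  x = iota u * (iota s * x + iota t * y) /\
    y = iota v * (iota s * x + iota t * y).
Proof.
have [a [b [b0 ->]]] := iota_frac x; have [c [d [d0 ->]]] := iota_frac y.
have i0 z : z != 0 -> iota z != 0.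
  by apply: contra_neq => e; apply: iota_inj; rewrite e rmorph0.
have [s [t [u [v [em en]]]]] := bezout (a * d) (c * b).
exists s, t, u, v.
have eA : iota a / iota b = iota (a * d) / iota (b * d).
  by apply/eqP; rewrite eqr_div ?i0 ?mulf_neq0 // -!rmorphM; apply/eqP;
    congr (iota _); mulAC.
have eC : iota c / iota d = iota (c * b) / iota (b * d).
  by apply/eqP; rewrite eqr_div ?i0 ?mulf_neq0 // -!rmorphM; apply/eqP;
    congr (iota _); mulAC.
have eS : iota s * (iota (a * d) / iota (b * d)) + iota t * (iota (c * b) /
  iota (b * d))
    = iota (s * (a * d) + t * (c * b)) / iota (b * d).
  by rewrite ![iota _ * (_ / _)]mulrA -!rmorphM -mulrDl -rmorphD.
by rewrite eA eC eS ![iota _ * (_ / _)]mulrA -!rmorphM -em -en.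
Qed.

Variable L : lmodType K0.

Definition lattice (M : L -> Prop) :=
  [/\ M 0, forall x y, M x -> M y -> M (x + y) & forall b x, M x ->
    M (iota b *: x)].

(** Treating only the finitely many values on [s] avoids generators of [M]. By Bezout, two values
    are multiples of a combination of them, which is again a value on [M]. *)
Lemma lattice_cyclic (M : L -> Prop) (c : L -> K0) (s : seq L) :
  lattice M -> scalar c -> (forall x, x \in s -> M x) ->
  exists w, M w /\ forall x, x \in s -> exists b, c x = iota b * c w.
Proof.
move=> [M0 MD MZ] hc; elim: s => [|x s IH] sM; first by exists 0.
have cD a b (y z : L) : c (iota a *: y + iota b *: z) =
  iota a * c y + iota b * c z.
  have c0 : c 0 = 0.
    by have := hc (-1) 0 0; rewrite scaler0 add0r mulN1r addNr.
  by rewrite hc -[X in _ + c X]addr0 hc c0 addr0.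
have [|w [Mw hw]] := IH; first by move=> y ys; apply: sM; rewrite inE ys orbT.
have [p [q [u [v [ex ew]]]]] := bezout_frac (c x) (c w).
exists (iota p *: x + iota q *: w); split.
  by apply: MD; apply: MZ => //; apply: sM; rewrite mem_head.
move=> y; rewrite inE => /orP[/eqP->|/hw[b eb]]; rewrite cD; first by exists u.
by exists (b * v); rewrite eb {1}ew rmorphM mulrA.
Qed.

(* Induction on [d]. The values of [c d] on the [u j] generate a cyclic
   [B]-module, so by the pigeonhole principle many of the [u j] have the same
   last coordinate after subtracting elements of [b M]; their differences lie
   in the kernel of [c d]. *)
Lemma lattice_bound (b : B) (d : nat) (c : nat -> L -> K0) :
  finite_residue b -> (forall i, scalar (c i)) ->
  exists N, forall M, lattice M ->
    (forall m, M m -> (forall i, (i < d)%N -> c i m = 0) -> m = 0) ->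
    forall (J : finType) (u : J -> L), (forall j, M (u j)) -> (N < #|J|)%N ->
    exists i j, i != j /\ exists m, M m /\ u i - u j = iota b *: m.
Proof.
move=> [X [r hr]] hc; elim: d => [|d [N IH]].
  exists 1%N => M [M0 _ _] Md J u Mu J1.
  have [i [j [_ _ ij]]] : exists i j : J, [/\ i \in J, j \in J & i != j].
    by apply/card_gt1P.
  exists i, j; split=> //; exists 0; split=> //.
  by rewrite scaler0 (Md (u i)) // (Md (u j)) // subrr.
exists (#|X| * N)%N => M hM Md J u Mu ltJ.
have [M0 MD MZ] := hM.
have MN x : M x -> M (- x).
  by move=> /(MZ (-1)); rewrite rmorphN1 scaleN1r.
have c0 i : c i 0 = 0.
  by have := hc i (-1) 0 0; rewrite scaler0 add0r mulN1r addNr.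
have cZ i a x : c i (a *: x) = a * c i x by rewrite -[a *: x]addr0 hc c0 addr0.
have cD i x y : c i (x + y) =
  c i x + c i y by rewrite -[x]scale1r hc mul1r scale1r.
have cN i x : c i (- x) = - c i x by rewrite -scaleN1r cZ mulN1r.
have [w [Mw hw]] : exists w, M w /\ forall x, x \in codom u ->
  exists b, c d x = iota b * c d w.
  by apply: lattice_cyclic hM (hc d) _ => x /codomP[j ->].
have /choice[beta hbeta] : forall j, exists b, c d (u j) = iota b * c d w.
  by move=> j; apply/hw/codom_f.
have [x hx] := @pigeonhole_fiber J X (r \o beta) N ltJ.
pose J' := {j | r (beta j) == x}.
have J'N : (N < #|{: J'}|)%N by rewrite card_sig.
have [j0] : exists j0 : J', true.
  by move: J'N; case: (pickP {: J'}) => [j0 _|no]; [exists j0|rewrite eq_card0].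
move=> _.
have /choice[gam hgam] : forall j : J', exists z,
  beta (val j) - beta (val j0) = b * z.
  by move=> j; apply: hr; rewrite (eqP (valP j)) (eqP (valP j0)).
pose u' (j : J') := u (val j) - u (val j0) - iota (b * gam j) *: w.
pose M' m := M m /\ c d m = 0.
have hM' : lattice M'.
  split; first by split.
  - by move=> y z [My cy] [Mz cz]; split; [exact: MD|rewrite cD cy cz addr0].
  - by move=> a y [My cy]; split; [exact: MZ|rewrite cZ cy mulr0].
have [| |i [j [ij [m [[Mm _] e]]]]] := IH _ hM' _ _ u' _ J'N.
- move=> m [Mm cm] hm; apply: Md => // i;
    rewrite ltnS leq_eqVlt => /orP[/eqP->//|].
  exact: hm.
- move=> j; split.
    exact: (MD _ _ (MD _ _ (Mu _) (MN _ (Mu _))) (MN _ (MZ _ _ Mw))).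
  by rewrite /u' !cD !cN cZ !hbeta -hgam rmorphB mulrBl subrr.
exists (val i), (val j); split; first by rewrite (inj_eq val_inj).
exists (m + iota (gam i) *: w - iota (gam j) *: w); split.
  exact: (MD _ _ (MD _ _ Mm (MZ _ _ Mw)) (MN _ (MZ _ _ Mw))).
rewrite scalerBr scalerDr -e /u' !scalerA -!rmorphM [X in _ =
  X - _]addrAC subrK.
by rewrite -[RHS]addrA -opprD subrK opprB subrKA.
Qed.

End Lattices.

(** The condition on [k] says that b / a is almost integral: [c] is a common denominator of all its
    powers. *)
Definition completely_integrally_closed (A : idomainType) :=
  forall a b c : A, a != 0 -> c != 0 ->
    (forall k, exists d, c * b ^+ k = a ^+ k * d) -> exists z, b = a * z.

Section IntegralClosure.
Variables (B : idomainType) (K0 : fieldType) (iota : {rmorphism B -> K0}).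
Hypothesis iota_inj : injective iota.
Hypothesis iota_frac : forall x : K0, exists a b : B,
  b != 0 /\ x = iota a / iota b.
Hypothesis bezout : forall m n : B, exists s t u v,
  m = u * (s * m + t * n) /\ n = v * (s * m + t * n).
Hypothesis residueB : forall b : B, b != 0 -> finite_residue b.
Variables (L : fieldExtType K0) (A : idomainType) (f : {rmorphism A -> L}).
Hypothesis f_inj : injective f.
Let h : {rmorphism B -> L} := in_alg L \o iota.
Hypothesis f_int : forall x : L, (exists a, f a = x) <-> integralOver h x.

Let f_eq0 a : (f a == 0) = (a == 0).
Proof. by rewrite -(rmorph0 f) (inj_eq f_inj). Qed.

(** The constant term of an equation for [a] is a multiple of [a]; factors ['X] are first cancelled
    until that term is nonzero. Cancelling may be iterated because the induction carries only a
    nonzero polynomial with root [f a]. *)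
Lemma dvd_constant (a : A) : a != 0 -> exists (b : B) (c d : A),
  [/\ b != 0, f c = h b & c = a * d].
Proof.
move=> a0; have [p mp] := (f_int (f a)).1 (ex_intro _ a erefl).
have := monic_neq0 mp; elim/poly_ind: p {mp} => [|p b IH];
  first by rewrite eqxx.
have [->|b0] := eqVneq b 0.
  rewrite addr0 => p0; rewrite rmorphM /= map_polyX rootM rootX f_eq0 (negbTE
    a0) orbF.
  by apply: IH; apply: contra_neq p0 => ->; rewrite mul0r.
move=> _ /rootP; rewrite rmorphD rmorphM /= map_polyX map_polyC !hornerE =>
  /eqP.
rewrite addrC addr_eq0 => /eqP e.
have [c ec] : exists c, f c = h b by apply/f_int/integral_id.
have [d ed] : exists d, f d = - (map_poly h p).[f a].
  apply/f_int/integral_opp/integral_horner; last by apply/f_int; exists a.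
  apply/integral_poly => i; rewrite coef_map; exact: integral_id.
exists b, c, d; split=> //; apply: f_inj.
by rewrite rmorphM ed ec e mulrN mulrC.
Qed.

(** It suffices to bound the residues modulo a multiple [b] of [a] coming from [B]. For this
    [lattice_bound] is applied to the image of [A], with the coordinates in a basis of [L],
    continued by 0 beyond the dimension, as functionals. *)
Lemma residueA (a : A) : a != 0 -> finite_residue a.
Proof.
move=> /dvd_constant[b [c [d [b0 ec ecd]]]].
pose co i (x : L) : K0 :=
  if insub i is Some j then coord (vbasis {:L}) j x else 0.
have co_lin i : scalar (co i).
  by move=> t x y; rewrite /co; case: insubP => [j _ _|_];
    rewrite ?linearP // mulr0 addr0.
have hZ e x : iota e *: x = h e * x by rewrite mulr_algl.
have [N hN] := @lattice_bound B K0 iota iota_inj iota_frac bezout L b (\dim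
  {:L}) co (residueB b0) co_lin.
apply: (@finite_residue_bound A a N) => J u ltJ.
have [||j|i [j [ij [_ [[z <-] e]]]]] :=
  hN (fun x => exists a, f a = x) _ _ J (f \o u) _ ltJ.
- split.
  + by exists 0; rewrite rmorph0.
  + by move=> _ _ [x <-] [y <-]; exists (x + y); rewrite rmorphD.
  + move=> e _ [x <-]; rewrite hZ.
    have [t <-] : exists t, f t = h e by apply/f_int/integral_id.
    by exists (t * x); rewrite rmorphM.
- move=> m _ m0; rewrite (coord_vbasis (memvf m)) big1 // => i _.
  have := m0 i (ltn_ord i); rewrite /co insubT //= => lt.
  by rewrite (_ : Sub _ _ = i) => [->|]; [rewrite scale0r|apply: val_inj].
- by exists (u j).
exists i, j; split=> //; exists (d * z); apply: f_inj.
by rewrite rmorphB /= e hZ -ec -rmorphM ecd mulrA.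
Qed.

Lemma root_monic_mem (p : {poly A}) (x : L) : p \is monic ->
  root (map_poly f p) x ->
  exists a, f a = x.
Proof.
move=> mp rp; apply/f_int/(integral_root_monic (monic_map f mp) rp).
by apply/integral_poly => i; rewrite coef_map; apply/f_int; exists p`_i.
Qed.

(* Two of the elements [c (b / a)^k] of [A] agree modulo [c], so [b / a] is a
   root of some ['X^j - 'X^i - z%:P]. *)
Lemma integral_closure_cic : completely_integrally_closed A.
Proof.
move=> a b c a0 c0 /choice[d hd].
have [X [r hr]] := residueA c0.
have [i [j [lt rij]]] : exists i j, (i < j)%N /\ r (d i) = r (d j).
  apply: contrapT => H.
  have inj : injective (fun i : 'I_(#|X|.+1) => r (d i)).
    move=> i j e; apply: val_inj; case: (ltngtP (val i) (val j)) => // lt;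
      case: H.
      by exists (val i), (val j).
    by exists (val j), (val i).
  by have := leq_card _ inj; rewrite card_ord ltnn.
have [z ez] := hr _ _ (esym rij).
have fa0 : f a != 0 by rewrite f_eq0.
have fd k : f (d k) = f c * (f b / f a) ^+ k.
  apply: (mulfI (expf_neq0 k fa0));
    rewrite -{1}rmorphXn -rmorphM -hd rmorphM rmorphXn.
  rewrite expr_div_n; transitivity (f c * f b ^+ k * (f a ^+ k / f a ^+ k));
    last by mulAC.
  by rewrite mulfV ?mulr1 ?expf_neq0.
have [||w ew] := @root_monic_mem ('X^j - ('X^i + z%:P)) (f b / f a).
- rewrite monicE lead_coefDl ?lead_coefXn // size_polyN size_polyXn.
  rewrite (leq_ltn_trans (size_polyD _ _)) // gtn_max !size_polyXn ltnS lt /=.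
  by rewrite (leq_ltn_trans (size_polyC_leq1 _)) // ltnS (leq_ltn_trans _ lt).
- rewrite rootE rmorphB rmorphD /= !map_polyXn map_polyC !hornerE /=.
  have fc0 : f c != 0 by rewrite f_eq0.
  rewrite -(inj_eq (mulfI fc0)) mulr0 mulrBr mulrDr -!fd -rmorphM -ez rmorphB.
  by rewrite subrKC subrr.
exists w; apply: f_inj; rewrite rmorphM ew mulrC divfK //.
Qed.

End IntegralClosure.

(** * Completely integrally closed domains with finite residue rings *)

Section Dedekind.
Variable A : idomainType.
Hypothesis resA : forall a : A, a != 0 -> finite_residue a.
Hypothesis cicA : completely_integrally_closed A.
Implicit Types (P : {pred A}).

Lemma residue_collision (a : A) (u : nat -> A) : a != 0 ->
  exists i j z, (i < j)%N /\ u j - u i = a * z.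
Proof.
move=> /resA[X [r hr]]; apply: contrapT => H.
have inj : injective (fun i : 'I_(#|X|.+1) => r (u i)).
  move=> i j e; apply: val_inj; case: (ltngtP (val i) (val j)) => // lt;
    case: H.
    by have [z ez] := hr _ _ (esym e); exists (val i), (val j), z.
  by have [z ez] := hr _ _ e; exists (val j), (val i), z.
by have := leq_card _ inj; rewrite card_ord ltnn.
Qed.

(** Two powers of [x] agree modulo [a], so [Q] contains x^i (x^(j-i) - 1). If [x] is not in [Q], the
    second factor lies in [Q], hence in [P], and then so does 1. *)
Lemma nonzero_prime_maximal P (Q : {pred A}) a :
  prime_ideal P -> prime_ideal Q -> a \in Q -> a != 0 -> {subset Q <= P} ->
    {subset P <= Q}.
Proof.
move=> hP hQ aQ a0 QP x xP; apply: contrapT => /negP xQ.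
have [i [j [z [lt e]]]] := residue_collision (fun i => x ^+ i) a0.
have : x ^+ i * (x ^+ (j - i) - 1) \in Q.
  by rewrite mulrBr -exprD subnKC ?mulr1 ?e ?primeMr // ltnW.
rewrite primeM // primeX // (negbTE xQ) andbF /= => /QP h.
have := prime1 hP; rewrite -[1 in X in X -> _](subKr (x ^+ (j - i))) primeB //.
by rewrite primeX // subn_gt0 lt.
Qed.

(** The ideal (aA : b), that is, the annihilator of the class of [b] in A/aA. *)
Definition colon (a b : A) : {pred A} :=
  fun x => `[< exists z, b * x = a * z >].

Lemma colonP a b x : reflect (exists z, b * x = a * z) (x \in colon a b).
Proof. exact: asboolP. Qed.

(* [A / a A] is finite, so among the good [b] there is one with [colon a b]
   maximal. *)
Lemma maximal_colon_prime a (good : A -> Prop) : a != 0 -> (exists b, good b) ->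
  (forall b, good b -> 1 \notin colon a b) ->
  (forall b x, good b -> x \notin colon a b ->
     good (b * x) \/ exists t, x \in colon a (b * t) /\ good (b * t)) ->
  exists b, good b /\ prime_ideal (colon a b).
Proof.
move=> a0 [b0 gb0] good1 goodM; have [X [r hr]] := resA a0.
pose img b : {set X} := [set t | `[< exists x, x \in colon a b /\ r x = t >]].
have imgE b t : (t \in img b) = `[< exists x,
  x \in colon a b /\ r x = t >] by rewrite inE.
have imgP b x : (x \in colon a b) = (r x \in img b).
  rewrite imgE; apply/idP/asboolP => [xb|[y [/colonP[z e] /hr[w ew]]]];
    first by exists x.
  apply/colonP; exists (z - b * w); rewrite mulrBr -e mulrCA -ew mulrBr.
  by rewrite opprB addrC subrK.
pose Pk k := `[< exists b, good b /\ #|img b| = k >].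
have ex : exists k, Pk k by exists #|img b0|; apply/asboolP; exists b0.
have bd k : Pk k -> (k <= #|X|)%N by move=> /asboolP[b [_ <-]]; apply: max_card.
case: (ex_maxnP ex bd) => k /asboolP[b [gb kb]] maxk.
have max b' : good b' -> (forall x, x \in colon a b -> x \in colon a b') ->
    forall x, x \in colon a b' -> x \in colon a b.
  move=> gb' sub x; suff -> : colon a b = colon a b' by [].
  have /eqP e : img b == img b'.
    rewrite eqEcard kb maxk; last by apply/asboolP; exists b'.
    rewrite andbT; apply/fintype.subsetP => t;
      rewrite !imgE => /asboolP[y [yb <-]].
    by apply/asboolP; exists y; split=> //; apply: sub.
  by apply/funext => y; have := imgP b y; rewrite e -imgP.
exists b; split=> //; split; first split.
- by apply/colonP; exists 0; rewrite !mulr0.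
- exact: good1.
- move=> c u v /colonP[z e] /colonP[w ew]; apply/colonP; exists (c * z + w).
  by rewrite mulrDr ew mulrCA e mulrDr; congr (_ + _); mulAC.
(* For [x] outside the colon ideal of [b], either [b * x] is good, and maximality puts [y] into that
   ideal, or some good [b * t] is annihilated by [x] modulo [a], which maximality excludes. *)
move=> x y xy; apply/orP.
have [|nx] := boolP (x \in colon a b); [by left|right].
have subM t z : z \in colon a b -> z \in colon a (b * t).
  by move=> /colonP[w e]; apply/colonP; exists (w * t); rewrite mulrAC e mulrA.
have [gx|[t [xt gt]]] := goodM _ _ gb nx.
  apply: (max _ gx (subM _)).
  by move: xy => /colonP[z e]; apply/colonP; exists z; rewrite -mulrA.
by case/negP: nx; apply: (max _ gt (subM _)).
Qed.

Section Uniformize.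
Variables (P : {pred A}) (hP : prime_ideal P) (a : A) (aP : a \in P) (a0 : a !=
  0).

(** The prime [P] is an associated prime of A/aA. The good [b] are those whose class survives
    localization at [P]; a maximal colon ideal among theirs is a prime inside [P] containing [a],
    hence equal to [P]. *)
Lemma colon_eq_prime : exists b, b \notin colon a 1 /\ forall x, x \in P ->
  x \in colon a b.
Proof.
pose good b := forall x, x \in colon a b -> x \in P.
have [|b gb|b x gb xb|b [gb hb]] := @maximal_colon_prime a good a0.
- by exists 1 => x /colonP[z]; rewrite mul1r => ->; apply: primeMr.
- by apply: contra (prime1 hP); apply: gb.
- have [gx|/existsNP[t /not_implyP[/colonP[w e] tP]]] :=
    pselect (good (b * x)); [by left|right].
  exists t; split; first by apply/colonP; exists w; rewrite -e mulrAC.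
  move=> z /colonP[v ev]; have : t * z \in P.
    by apply: gb; apply/colonP; exists v; rewrite mulrA.
  by rewrite primeM // => /orP[].
have ab : a \in colon a b by apply/colonP; exists b; rewrite mulrC.
exists b; split; last exact: nonzero_prime_maximal hP hb ab a0 gb.
apply/negP => /colonP[z]; rewrite mul1r => e.
by move: (prime1 hb) => /colonP; apply; exists z; rewrite mulr1.
Qed.

(* [b / a] maps [P] into [A], but not into [P], for otherwise it would be
   almost integral. A [c] in [P] with [b / a * c] outside [P] is a
   uniformizer. *)
Lemma nonzero_prime_dvr : dvr P.
Proof.
have [b [nb hb]] := colon_eq_prime.
have [c [s [cP sP e]]] : exists c s, [/\ c \in P, s \notin P & b * c = a * s].
  apply: contrapT => H; case/negP: nb; apply/colonP.
  have step k : exists d, d \in P /\ a * b ^+ k = a ^+ k * d.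
    elim: k => [|k [d [dP e]]]; first by exists a; rewrite !expr0 mulr1 mul1r.
    have /colonP[z ez] := hb _ dP.
    exists z; split.
      by apply: contrapT => /negP zP; apply: H; exists d, z.
    by rewrite exprS mulrCA e mulrCA ez exprS; mulAC.
  have [k|z ->] := cicA (b := b) a0 a0; last by exists z; rewrite mul1r.
  by have [d [_ ed]] := step k; exists d.
have c0 : c != 0.
  apply: contraTneq (mulf_neq0 a0 (notin_prime_neq0 hP sP)) => c0.
  by rewrite -e c0 mulr0 eqxx.
have div x : x \in P -> exists y, s * x = c * y.
  move=> /hb/colonP[y ey]; exists y; apply: (mulfI a0).
  by rewrite mulrA -e mulrAC ey; mulAC.
exists c; split=> // x x0; apply: contrapT => H.
(* If [x] had no order, it could be divided by c / s indefinitely. This makes s / c almost integral,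
   so [s] would be a multiple of [c] and lie in [P]. *)
have step k : exists y, y \in P /\ s ^+ k * x = c ^+ k * y.
  elim: k => [|k [y [yP ey]]].
    exists x; rewrite !expr0; split=> //; apply: contrapT => /negP xP.
    by apply: H; exists 0%N, 1, x; rewrite expr0; split=> //; apply: prime1.
  have [z ez] := div _ yP; have ez' : s ^+ k.+1 * x = c ^+ k.+1 * z.
    by rewrite exprS -mulrA ey mulrCA ez exprS; mulAC.
  exists z; split=> //; apply: contrapT => /negP zP; apply: H.
  by exists k.+1, (s ^+ k.+1), z; split=> //; rewrite primeX.
have [k|z ez] := cicA (b := s) c0 x0.
  by have [y [_ ey]] := step k; exists y; rewrite mulrC.
by move: sP; rewrite ez primeMr.
Qed.

End Uniformize.

Lemma dedekind_krull : krull A.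
Proof.
have hd (P : height1 A) : dvr P.
  have [x xP x0] := height1_neq0 P.
  exact: nonzero_prime_dvr (height1_prime P) _ xP x0.
have h1 P : prime_ideal P -> forall x, x \in P -> x != 0 ->
  exists Q : height1 A, P = Q.
  by move=> hP x xP x0; exists (height1_of (nonzero_prime_dvr hP xP x0)).
split=> //.
(* A prime containing [x] is determined by its image modulo [x], a subset of a finite type. *)
- move=> x x0; have [X [r hr]] := resA x0.
  pose img (P : height1 A) : {set X} :=
    [set t | `[< exists y, y \in P /\ r y = t >]].
  have imgE (P : height1 A) t : (t \in img P) = `[< exists y,
    y \in P /\ r y = t >] by rewrite inE.
  have imgP (P : height1 A) y : x \in P -> (y \in P) = (r y \in img P).
    move=> xP; have hP := height1_prime P; rewrite imgE.
    apply/idP/asboolP => [yP|[z [zP /hr[w ew]]]]; first by exists y.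
    by rewrite -[y](subKr z) primeB // ew primeMr.
  have inj : {in [set P : height1 A | x \in P]%classic &, injective img}.
    move=> P Q; rewrite !inE /= => xP xQ e; apply: height1_eq => y.
    by rewrite (imgP P y xP) (imgP Q y xQ) e.
  rewrite -(eq_finite_set (inj_card_eq inj)); exact: finite_finset.
- move=> x y x0 y0 le; apply: contrapT => ndvd.
  (* If [x] does not divide [y], some multiple of [y] has a prime colon ideal. Dividing [y] by [x]
     locally at this prime produces an element of the colon ideal outside the prime. *)
  pose good b := (exists c, b = y * c) /\ 1 \notin colon x b.
  have [|b []//|b z [[c ->] _] zb|b [[[c ->] n1] hb]] :=
    @maximal_colon_prime x good x0.
  + exists y; split; first by exists 1; rewrite mulr1.
    by apply/negP => /colonP[z]; rewrite mulr1 => e; apply: ndvd; exists z.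
  + left; split; first by exists (c * z); rewrite mulrA.
    by apply: contra zb => /colonP[w]; rewrite mulr1 => e; apply/colonP;
      exists w.
  have xP : x \in colon x (y * c) by apply/colonP; exists (y * c);
    rewrite mulrC.
  have [Q eQ] := h1 _ hb _ xP x0.
  have [s [r [sQ e]]] := (vord_leP (hd Q) x0 y0).1 (le Q).
  move: sQ; rewrite -eQ => /colonP; apply; exists (r * c).
  by rewrite mulrA -e; mulAC.
Qed.

End Dedekind.

Lemma bezout_int (m n : int) : exists s t u v : int,
  m = u * (s * m + t * n) /\ n = v * (s * m + t * n).
Proof.
have [s [t e]] := Bezoutz m n.
have /dvdzP[u eu] := dvdz_gcdl m n; have /dvdzP[v ev] := dvdz_gcdr m n.
by exists s, t, u, v; rewrite e.
Qed.

Lemma residue_int (b : int) : b != 0 -> finite_residue b.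
Proof.
move=> b0; exists 'I_(`|b|%N.+1), (fun z => inord `|(z %% b)%Z|%N) =>
  x y /(congr1 val).
have lt z : (`|(z %% b)%Z| < `|b|.+1)%N.
  by rewrite ltnS -lez_nat !abszE ger0_norm ?modz_ge0 // ltW // ltz_mod.
rewrite /= !inordK // => /(congr1 Posz); rewrite !gez0_abs ?modz_ge0 // => e.
have /dvdzP[z ez] : (b %| x - y)%Z by rewrite -eqz_mod_dvd; apply/eqP.
by exists z; rewrite ez mulrC.
Qed.

Lemma bezout_poly (F : fieldType) (m n : {poly F}) : exists s t u v : {poly F},
  m = u * (s * m + t * n) /\ n = v * (s * m + t * n).
Proof.
have [[s t] /= e] := Bezoutp m n.
have /dvdpP[u eu] : s * m + t * n %| m by rewrite (eqp_dvdl _ e) dvdp_gcdl.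
have /dvdpP[v ev] : s * m + t * n %| n by rewrite (eqp_dvdl _ e) dvdp_gcdr.
by exists s, t, u, v.
Qed.

Lemma residue_poly (F : finFieldType) (b : {poly F}) : b != 0 ->
  finite_residue b.
Proof.
move=> b0; exists 'rV[F]_(size b), (fun p => poly_rV (p %% b)) => x y.
have lt p : (size (p %% b)%R <= size b)%N by rewrite ltnW // ltn_modp.
move/(congr1 rVpoly); rewrite !poly_rV_K // => e.
have /dvdpP[z ez] : b %| x - y.
  by rewrite /dvdp modpD modpN e subrr.
by exists z; rewrite ez mulrC.
Qed.

Lemma ratP (x : rat) : exists a b : int, b != 0 /\ x = a%:~R / b%:~R.
Proof. by exists (numq x), (denq x); rewrite divq_num_den. Qed.

Lemma integral_closure_krull (B : idomainType) (K0 : fieldType) (iota :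
  {rmorphism B -> K0})
    (L : fieldExtType K0) (A : idomainType) :
  injective iota ->
  (forall x : K0, exists a b : B, b != 0 /\ x = iota a / iota b) ->
  (forall m n : B, exists s t u v,
    m = u * (s * m + t * n) /\ n = v * (s * m + t * n)) ->
  (forall b : B, b != 0 -> finite_residue b) ->
  is_integral_closure A (in_alg L \o iota) -> krull A.
Proof.
move=> inj frac bez res [f [f_inj f_int]]; apply: dedekind_krull.
  by move=> a a0; exact: (residueA inj frac bez res f_inj f_int a0).
exact: (integral_closure_cic inj frac bez res f_inj f_int).
Qed.

Lemma global_krull (A : idomainType) : is_global_ring_of_integers A -> krull A.
Proof.
case=> [[L hL]|[Fq [L hL]]].
  apply: (@integral_closure_krull int rat (@intmul rat 1) L).
  - exact: intr_inj.
  - exact: ratP.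
  - exact: bezout_int.
  - exact: residue_int.
  - suff -> : (in_alg L \o (@intmul rat 1 : {rmorphism int -> rat}) : int -> L)
      = (fun z : int => z%:~R) by [].
    by apply/funext => z /=; rewrite scaler_int.
apply: (@integral_closure_krull _ _ (@tofrac {poly Fq}) L).
- by move=> x y /eqP; rewrite tofrac_eq => /eqP.
- exact: fractionP.
- exact: bezout_poly.
- exact: residue_poly.
- exact: hL.
Qed.

(** * Valuations of a ring of invariants *)

Lemma prime_avoidance (R : idomainType) (I : eqType) (P : I ->
  {pred R}) (J : {pred R}) (r : seq I) :
  prime_ideal J -> (forall i, prime_ideal (P i)) ->
  (forall i j, {subset P i <= P j} -> {subset P j <= P i}) ->
  (forall i, i \in r -> ~ {subset J <= P i}) ->
  exists2 x, x \in J & forall i, i \in r -> x \notin P i.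
Proof.
move=> hJ hP Pmin; elim: r => [|i r IH] nJ; first by exists 0; rewrite ?prime0.
have [|x xJ xr] := IH; first by move=> j jr; apply: nJ; rewrite inE jr orbT.
have [xi|xi] := boolP (x \in P i); last first.
  by exists x => // j; rewrite inE => /orP[/eqP->|/xr].
have /existsNP[z /not_implyP[zJ /negP zi]] := nJ i (mem_head _ _).
(* An inclusion of [P j] in [P i] would be an equality by [Pmin], and put [x] into [P j]. *)
have /choice[t ht] : forall j, exists t, j \in r -> t \in P j /\ t \notin P i.
  move=> j; have [jr|_] := boolP (j \in r); last by exists 0.
  have [sub|/existsNP[t /not_implyP[tj /negP ti]]] :=
    pselect {subset P j <= P i}.
    by have := xr j jr; rewrite (Pmin _ _ sub _ xi).
  by exists t.
pose y := z * \prod_(j <- r) t j.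
have yi : y \notin P i.
  rewrite primeM // negb_or zi big_seq prime_prod // => j jr.
  by have [] := ht j jr.
have yr j : j \in r -> y \in P j.
  move=> jr; rewrite primeM // (perm_big _ (perm_to_rem jr)) big_cons primeM //.
  by have [-> _] := ht j jr; rewrite orbT.
exists (x + y); first by rewrite primeD // /y primeMr.
move=> j; rewrite inE => /orP[/eqP->|jr].
  apply: contra yi => h; rewrite -[y](addrK x) addrC primeD // ?primeN //.
  by rewrite addrC.
by apply: contra (xr j jr) => h; rewrite -[x](addrK y) primeB // yr.
Qed.

(** Elements outside the contraction have value 0 at [Q], so only the uniformizer contributes. The
    factor is the ramification index, by [ramificationE]. *)
Lemma vord_extension (S R : idomainType)
    (phi : {rmorphism S -> R}) (Q : {pred R}) (x : S) :
  injective phi -> dvr Q -> dvr (contraction phi Q) -> x != 0 ->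
  vord Q (phi x) = (vord (contraction phi Q) x *
    vord Q (phi (unif (contraction phi Q))))%N.
Proof.
move=> phi_inj hQ hq x0; set q := contraction phi Q.
have phi0 (z : S) : z != 0 -> phi z != 0.
  by apply: contra_neq => e; apply: phi_inj; rewrite e rmorph0.
have [s [r [sq rq /(congr1 (fun z => vord Q (phi z)))]]] := vordP hq x0.
have pq := dvr_prime hq; have [_ _ u0 _] := unifP hq.
have s0 := notin_prime_neq0 pq sq; have r0 := notin_prime_neq0 pq rq.
rewrite !rmorphM rmorphXn !vordM ?vordX ?phi0 ?expf_neq0 ?phi0 //.
have hs : vord Q (phi s) = 0%N by exact: (vord_notin hQ (sq : phi s \notin Q)).
have hr : vord Q (phi r) = 0%N by exact: (vord_notin hQ (rq : phi r \notin Q)).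
by rewrite hs hr add0n addn0.
Qed.

Section Invariants.
Variables (R S : idomainType)
    (phi : {rmorphism S -> R}) (gT : finGroupType) (G : {group gT}).
Variable sigma : gT -> {rmorphism R -> R}.
Hypothesis phi_inj : injective phi.
Hypothesis sigma1 : forall x, sigma 1%g x = x.
Hypothesis sigmaM : forall g h x, g \in G -> h \in G ->
  sigma (g * h)%g x = sigma g (sigma h x).
Hypothesis sigma_phi : forall g x, g \in G -> sigma g (phi x) = phi x.
Hypothesis phi_inv : forall x, (forall g, g \in G -> sigma g x = x) ->
  exists y, phi y = x.
Hypothesis hR : krull R.

Let phi0 (z : S) : z != 0 -> phi z != 0.
Proof. by apply: contra_neq => e; apply: phi_inj; rewrite e rmorph0. Qed.

Let hd (Q : height1 R) : dvr Q. Proof. by have [] := hR. Qed.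

Lemma sigmaK g : g \in G -> cancel (sigma g) (sigma g^-1%g).
Proof. by move=> gG x; rewrite -sigmaM ?groupV // mulVg sigma1. Qed.

Lemma sigmaVK g : g \in G -> cancel (sigma g^-1%g) (sigma g).
Proof. by move=> gG x; rewrite -sigmaM ?groupV // mulgV sigma1. Qed.

Lemma phi_div (x y : S) (z : R) : x != 0 -> phi y = phi x * z ->
  exists w, y = x * w.
Proof.
move=> x0 e; have [g gG|w ew] := @phi_inv z.
  by apply: (mulfI (phi0 x0));
    rewrite -e -{1}(sigma_phi x gG) -rmorphM -e sigma_phi.
by exists w; apply: phi_inj; rewrite rmorphM ew.
Qed.

(** An invariant multiple of [x]: the means of passing from an ideal of [R] to its contraction. *)
Definition group_norm x := \prod_(g in G) sigma g x.

Lemma group_norm_invariant x : exists y, phi y = group_norm x.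
Proof.
apply: phi_inv => g gG;
  rewrite /group_norm rmorph_prod [RHS](reindex_inj (mulgI g)) /=.
by apply: eq_big => [h|h hG]; rewrite ?groupMl ?sigmaM.
Qed.

Lemma group_norm_dvd x : exists z, group_norm x = x * z.
Proof. by rewrite /group_norm (bigD1 1%g) //= sigma1; eexists. Qed.

Lemma group_norm_neq0 x : x != 0 -> group_norm x != 0.
Proof.
move=> x0; apply/prodf_neq0 => g gG; apply: contra_neq x0 => e.
by rewrite -[x](sigmaK gG) e rmorph0.
Qed.

Section Conjugate.
Variables (Q : height1 R) (g : gT).
Hypothesis gG : g \in G.

Lemma conj_prime_dvr : dvr (contraction (sigma g) Q).
Proof. exact: (dvr_iso (sigmaK gG) (sigmaVK gG) (hd Q)). Qed.

Definition conj_prime : height1 R := height1_of conj_prime_dvr.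

Lemma vord_conj x : x != 0 -> vord conj_prime x = vord Q (sigma g x).
Proof. by move=> x0; exact: (vord_iso (sigmaK gG) (sigmaVK gG) (hd Q) x0). Qed.

Lemma contraction_conj : contraction phi conj_prime =i contraction phi Q.
Proof.
by move=> x; rewrite -[LHS]/(sigma g (phi x) \in Q) sigma_phi.
Qed.
End Conjugate.

(** Otherwise some element of [Q'] avoids all conjugates of [Q], and its norm lies in the
    contraction of [Q'] but not in that of [Q]. An inclusion is what [local_div] provides, hence the
    form of the hypothesis. *)
Lemma contraction_sub_conj (Q Q' : height1 R) :
  {subset contraction phi Q' <= contraction phi Q} ->
  exists g (gG : g \in G), Q' = conj_prime Q gG.
Proof.
move=> sub; apply: contrapT => /forallNP H.
(* As [conj_prime] takes a proof of membership in [G], the family is completed by the dummy value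
   [Q] outside [G]. *)
pose P g := if @idP (g \in G) is ReflectT gG then conj_prime Q gG else Q.
have Pg g (gG : g \in G) : P g = conj_prime Q gG.
  rewrite /P; case: {-}_ / idP => [gG'|//]; congr conj_prime;
    exact: Prop_irrelevance.
have [||||x xQ' xP] := @prime_avoidance _ _
    (fun g => P g : {pred R}) Q' (enum G).
- exact: height1_prime.
- by move=> g; apply: height1_prime.
- by move=> g h /height1_eq_sub->.
- move=> g; rewrite mem_enum => gG /height1_eq_sub; rewrite (Pg g gG) => e.
  by apply: (H g); exists gG.
have [y ey] := group_norm_invariant x; have [z ez] := group_norm_dvd x.
have : y \in contraction phi Q'.
  by rewrite contractionE ey ez primeMr //; apply: height1_prime.
move/sub; rewrite contractionE ey; apply/negP/prime_prod;
  first exact: height1_prime.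
by move=> g gG; have := xP g; rewrite mem_enum (Pg g gG) => /(_ gG).
Qed.

Section Contraction.
Variable Q : height1 R.
Let q := contraction phi Q.

Let pq : prime_ideal q.
Proof. exact/contraction_prime/height1_prime. Qed.

(** By [contraction_sub_conj], the only primes to be tested in [local_div] are the conjugates of
    [Q], and these all have the same values on [S]. *)
Lemma contraction_local_div (x y : S) : x != 0 -> y != 0 ->
  (vord Q (phi x) <= vord Q (phi y))%N ->
    exists s w, s \notin q /\ s * y = x * w.
Proof.
move=> x0 y0 le; apply: (local_div phi_inj phi_div hR pq x0 y0) => i.
move=> /contraction_sub_conj[g [gG ->]].
by rewrite !vord_conj ?phi0 // !sigma_phi.
Qed.

Lemma contraction_neq0 : exists2 y, y \in q & y != 0.
Proof.
have [x xQ x0] := height1_neq0 Q.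
have [y ey] := group_norm_invariant x; have [z ez] := group_norm_dvd x.
exists y; first by rewrite contractionE ey ez primeMr //; apply: height1_prime.
by apply: contraTneq (group_norm_neq0 x0) => y0; rewrite -ey y0 rmorph0 eqxx.
Qed.

(* A uniformizer is obtained from a fraction [x / y] whose value is the least
   positive one on the fraction field of [S]. *)
Lemma contraction_dvr : dvr q.
Proof.
have [w wE] : exists w : S -> nat, forall x, w x = vord Q (phi x) by eexists.
have wM x y : x != 0 -> y != 0 -> w (x * y) = (w x + w y)%N.
  by move=> x0 y0; rewrite !wE rmorphM vordM ?phi0.
have wX x k : x != 0 -> w (x ^+ k) = (k * w x)%N.
  by move=> x0; rewrite !wE rmorphXn vordX ?phi0.
have w0 s : s \notin q -> w s = 0%N by move=> sq; rewrite !wE vord_notin.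
have q0 x : x \notin q -> x != 0 := @notin_prime_neq0 _ _ pq x.
pose diff k := `[< exists x y, [/\ x != 0, y != 0, (0 < k)%N
  & w x = (w y + k)%N] >].
have exk : exists k, diff k.
  have [y yq y0] := contraction_neq0; exists (w y); apply/asboolP; exists y, 1.
  by rewrite oner_eq0 !wE vord_gt0 ?phi0 // (@vord_notin _ _ (hd Q) (phi 1)) //
    rmorph1 prime1 //; apply: height1_prime.
case: (ex_minnP exk) => e /asboolP[x [y [x0 y0 e0 exy]]] mine.
have [|s [pi [sq es]]] := contraction_local_div y0 x0;
  first by rewrite -!wE exy leq_addr.
have pi0 : pi != 0.
  by apply: contraTneq (mulf_neq0 (q0 _ sq) x0) => pi0;
    rewrite es pi0 mulr0 eqxx.
have wpi : w pi = e.
  apply/eqP; rewrite -(eqn_add2l (w y)) -wM // -es.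
  by rewrite (wM _ _ (q0 _ sq) x0) w0 // exy.
exists pi; split=> //.
  by rewrite contractionE -(vord_gt0 (hd Q)) ?phi0 // -wE wpi.
move=> z z0; pose k := (w z %/ e)%N; exists k.
(* A nonzero remainder would be a positive value of z / pi^k smaller than [e]. *)
have wz : w z = w (pi ^+ k).
  have ez := divn_eq (w z) e; rewrite wX // wpi {1}ez -/k.
  have [->|r0] := posnP (w z %% e)%N; first by rewrite addn0.
  have : (e <= w z %% e)%N.
    apply: mine; apply/asboolP; exists z, (pi ^+ k);
      by rewrite expf_neq0 // wX // wpi.
  by rewrite leqNgt ltn_pmod.
have [|t [r [tq et]]] := contraction_local_div (expf_neq0 k pi0) z0;
  first by rewrite -!wE wz.
exists t, r; split=> //.
have r0 : r != 0.
  by apply: contraTneq (mulf_neq0 (q0 _ tq) z0) => r0; rewrite et r0 mulr0 eqxx.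
rewrite contractionE -(vord_eq0 (hd Q)) ?phi0 // -wE.
by rewrite -(eqn_add2l (w (pi ^+ k))) -wM ?expf_neq0 // -et (wM _ _ (q0 _ tq)
  z0) w0 // wz addn0.
Qed.

Definition contracted_prime : height1 S := height1_of contraction_dvr.
End Contraction.

Lemma height1_contr (P : height1 S) : exists Q, P = contracted_prime Q.
Proof.
have [x xP x0] := height1_neq0 P.
have [Q [xQ sub]] := contraction_sub_prime phi_inj phi_div hR (height1_prime P)
  xP x0.
by exists Q; apply/esym/height1_eq_sub.
Qed.

Lemma invariant_dvr (P : height1 S) : dvr P.
Proof. by have [Q ->] := height1_contr P; apply: contraction_dvr. Qed.

Lemma invariant_finite : finite_char (@height1_pred S).
Proof.
move=> x x0; have [_ hf _] := hR.
apply: sub_finite_set (finite_image contracted_prime (hf _ (phi0 x0))) =>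
  P /= xP.
by have [Q e] := height1_contr P; exists Q => //=; move: xP; rewrite e.
Qed.

End Invariants.

(** * Lengths, divisors and class groups *)

Section DvrLength.
Variables (T : idomainType) (P : {pred T}) (hP : dvr P).
Let V : set {fraction T} := localization P.
Let pi : {fraction T} := tofrac (unif P).
Let pP := dvr_prime hP.
Local Notation iota := (@tofrac T).

Let pi0 : pi != 0.
Proof. by have [_ _ u0 _] := unifP hP; rewrite tofrac_eq0. Qed.

Let notin0 s : s \notin P -> iota s != 0.
Proof. by move=> sP; rewrite tofrac_eq0 (notin_prime_neq0 pP sP). Qed.

Let V_iota a : V (iota a).
Proof. by exists a, 1; rewrite (prime1 pP) rmorph1 divr1. Qed.

Let V_inv a s : s \notin P -> V (iota a / iota s). Proof. by move=> sP;
  exists a, s. Qed.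

Let VM x y : V x -> V y -> V (x * y).
Proof.
move=> [a [s [sP ->]]] [b [t [tP ->]]]; exists (a * b), (s * t).
by rewrite primeM // negb_or sP tP mulf_div !rmorphM.
Qed.

Let VD x y : V x -> V y -> V (x + y).
Proof.
move=> [a [s [sP ->]]] [b [t [tP ->]]]; exists (a * t + b * s), (s * t).
by rewrite primeM // negb_or sP tP addf_div ?notin0 // rmorphD !rmorphM.
Qed.

Let ideal (k : nat) : set {fraction T} :=
  [set x | exists v, V v /\ x = pi ^+ k * v]%classic.

Let ideal_submod k : is_submod V (ideal k).
Proof.
split.
- by exists 0; rewrite mulr0; split=> //; rewrite -(rmorph0 iota);
    exact: V_iota.
- by move=> _ _ [v [Vv ->]] [w [Vw ->]]; exists (v + w); rewrite mulrDr;
    split=> //; apply: VD.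
- by move=> w _ Vw [v [Vv ->]]; exists (w * v); rewrite mulrCA; split=> //;
    apply: VM.
Qed.

Let V_unit_dec x : V x -> x != 0 ->
  exists k u, [/\ V u, V u^-1, u != 0 & x = pi ^+ k * u].
Proof.
move=> [a [s [sP ->]]] x0.
have a0 : a != 0 by apply: contra_neq x0 => ->; rewrite rmorph0 mul0r.
have [t [r [tP rP e]]] := vordP hP a0.
exists (vord P a), (iota r / iota (t * s)).
have tsP : t * s \notin P by rewrite primeM // negb_or tP.
split; [exact: V_inv|by rewrite invf_div; apply: V_inv| |].
  by rewrite mulf_neq0 ?invr_eq0 ?notin0.
apply: (mulIf (notin0 tsP)); rewrite -[RHS]mulrA divfK ?notin0 //.
rewrite rmorphM [iota t * _]mulrC mulrA divfK ?notin0 // mulrC.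
by rewrite -rmorphM e rmorphM rmorphXn.
Qed.

Let submod_ideal J k : is_submod V J -> J (pi ^+ k) -> (ideal k `<=` J)%classic.
Proof. by move=> [_ _ JM] Jk _ [v [Vv ->]]; rewrite mulrC; apply: JM. Qed.

Let submod_ideal_min J k : is_submod V J -> (J `<=` V)%classic ->
  (forall l, J (pi ^+ l) -> (k <= l)%N) -> (J `<=` ideal k)%classic.
Proof.
move=> [_ _ JM] JV mink x Jx; have [->|x0] := eqVneq x 0.
  by have [] := ideal_submod k.
have [l [u [Vu Vu' u0 e]]] := V_unit_dec (JV _ Jx) x0.
have kl : (k <= l)%N.
  by apply: mink; have := JM _ _ Vu' Jx; rewrite e mulrCA mulVf // mulr1.
exists (pi ^+ (l - k) * u); rewrite mulrA -exprD subnKC //; split=> //.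
by apply: VM => //; rewrite -rmorphXn; exact: V_iota.
Qed.

Let ideal_strict k : (ideal k.+1 `<` ideal k)%classic.
Proof.
split=> [_ [v [Vv ->]]|].
  exists (pi * v); rewrite mulrA exprSr; split=> //; apply: VM => //;
    exact: V_iota.
move/(_ (pi ^+ k)); case.
  by exists 1; rewrite mulr1; split=> //; rewrite -(rmorph1 iota);
    exact: V_iota.
move=> v [[a [s [sP ->]]]]; rewrite exprSr -mulrA -[X in X = _]mulr1.
move=> /(mulfI (expf_neq0 k pi0)) e.
have [_ uP _ _] := unifP hP.
have es : s = unif P * a.
  apply/eqP; rewrite -tofrac_eq rmorphM -[iota s]mul1r e mulrA divfK ?notin0 //.
by move: sP; rewrite es primeMr.
Qed.

(** The nonzero ideals of the valuation ring [V] are generated by powers of the uniformizer, and [Y]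
    spans the one of exponent [m]. A single element as [Y] yields [valuation], the image of a
    contracted prime yields [ramification]. *)
Lemma quo_length_dvr (Y : set T) (m : nat) :
  (exists2 y, Y y & y != 0 /\ vord P y = m) ->
  (forall y, Y y -> y != 0 -> (m <= vord P y)%N) ->
  quo_length V V (submod_span V [set iota y | y in Y]%classic) = m.
Proof.
move=> [y Yy [y0 ym]] Ym; set X := (X in submod_span _ X).
have V0 : V = ideal 0.
  apply/seteqP; split=> [x Vx|_ [v [Vv ->]]]; last by rewrite expr0 mul1r.
  by exists x; rewrite expr0 mul1r.
have NE : submod_span V X = ideal m.
  apply/seteqP; split=> [x|x Ix J hJ XJ].
    apply; first exact: ideal_submod.
    move=> _ [z Yz <-]; have [->|z0] := eqVneq z 0.
      by rewrite rmorph0; have [] := ideal_submod m.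
    have [t [r [tP rP e]]] := vordP hP z0; have le := Ym _ Yz z0.
    exists (pi ^+ (vord P z - m) * (iota r / iota t)); split.
      by apply: VM; [rewrite -rmorphXn; apply: V_iota|apply: V_inv].
    rewrite mulrA -exprD subnKC //; apply: (mulIf (notin0 tP)).
    by rewrite -[RHS]mulrA divfK ?notin0 // -rmorphXn -!rmorphM mulrC e.
  apply: (submod_ideal hJ) Ix.
  have [t [r [tP rP e]]] := vordP hP y0; rewrite ym in e.
  have [_ _ JM] := hJ.
  have -> : pi ^+ m = (iota t / iota r) * iota y.
    apply: (mulIf (notin0 rP)); rewrite mulrAC divfK ?notin0 //.
    by rewrite -rmorphXn -!rmorphM e.
  by apply: JM; [exact: V_inv|apply: XJ; exists y].
have chm : submod_chain V V (ideal m) m.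
  exists (fun i => ideal (m - i)); split.
  - by rewrite subn0.
  - by rewrite subnn.
  - by move=> i _.
  - by move=> i im; rewrite -[(m - i)%N]subnSK //; apply: ideal_strict.
have maxm k : submod_chain V V (ideal m) k -> (k <= m)%N.
  move=> [c [c0 ck hc sc]].
  have cmono i j : (i <= j)%N -> (j <= k)%N -> (c i `<=` c j)%classic.
    elim: j => [|j IH]; first by rewrite leqn0 => /eqP-> _ x.
    rewrite leq_eqVlt => /orP[/eqP-> _ x //|ij jk].
    by apply: classical_sets.subset_trans (IH ij (ltnW jk)) _;
      have [] := sc j jk.
  (* Each strict step lowers the least exponent of a power of the uniformizer in the submodule, and
     the first submodule contains the power of exponent [m]. *)
  have memc i : (i <= k)%N -> exists j, (j + i <= m)%N /\ c i (pi ^+ j).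
    elim: i => [|i IH] ik.
      exists m; rewrite addn0; split=> //; rewrite c0; exists 1.
      by rewrite mulr1; split=> //; rewrite -(rmorph1 iota); exact: V_iota.
    have [j [jm cj]] := IH (ltnW ik).
    have ex : exists j, `[< c i.+1 (pi ^+ j) >].
      by exists j; apply/asboolP; apply: (cmono i i.+1).
    case: (ex_minnP ex) => l /asboolP cl minl; exists l; split=> //.
    rewrite addnS -addSn (leq_trans _ jm) // leq_add2r ltnNge; apply/negP => jl.
    have [_] := sc i ik; apply.
    apply: classical_sets.subset_trans (submod_ideal (hc i (ltnW ik)) cj).
    apply: submod_ideal_min; first exact: hc.
      by rewrite -ck; apply: cmono.
    by move=> e /asboolP/minl; apply: leq_trans.
  by have [j [+ _]] := memc k (leqnn k); apply: leq_trans; apply: leq_addl.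
rewrite /quo_length NE; apply: xget_unique; first by split.
by move=> k [chk maxk]; apply/eqP; rewrite eqn_leq maxm // maxk.
Qed.
End DvrLength.

Lemma valuationE (T : idomainType) (P : height1 T) (a : T) :
  dvr P -> a != 0 -> valuation P a = vord P a.
Proof.
move=> hP a0; rewrite /valuation.
have -> : [set tofrac a]%classic =
  [set tofrac y | y in [set a]]%classic by rewrite image_set1.
apply: quo_length_dvr => //; first by exists a.
by move=> _ ->.
Qed.

Lemma ramificationE (S R : idomainType)
    (phi : {rmorphism S -> R}) (Q : height1 R) :
  injective phi -> dvr Q -> dvr (contraction phi Q) ->
  ramification phi Q = vord Q (phi (unif (contraction phi Q))).
Proof.
move=> phi_inj hQ hq; have [_ uq u0 _] := unifP hq.
rewrite /ramification.
have -> : [set tofrac (phi a) | a in [set a | a \in contraction phi Q]]%classic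
   = [set tofrac y | y in [set phi a | a in [set a | a \in contraction phi
     Q]]]%classic.
  by rewrite -image_comp.
have phi0 (z : S) : z != 0 -> phi z != 0.
  by apply: contra_neq => e; apply: phi_inj; rewrite e rmorph0.
apply: quo_length_dvr => //.
  by exists (phi (unif (contraction phi Q)));
    [exists (unif (contraction phi Q))|rewrite phi0].
move=> _ [a aq <-] fa0.
have a0 : a != 0 by apply: contra_neq fa0 => ->; rewrite rmorph0.
by rewrite (vord_extension phi_inj hQ hq a0) leq_pmull // vord_gt0.
Qed.

(** Finiteness of the support keeps the sum from taking its default value 0. *)
Lemma coeff_fsum (T : choiceType) (D : set T) (f : T -> int) (x : T) :
  finite_set (D `&` [set y | f y != 0])%classic ->
  coeff x (\sum_(y \in D) << f y *g y >>) = if x \in D then f x else 0.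
Proof.
move=> fin; have /finite_seqP[r er] := fin.
have := @fsbigE _ 0 +%R _ D (undup r) (fun y => << f y *g y >>).
rewrite undup_uniq => -> //; first last.
- move=> i Di; rewrite mem_undup => ir; have [->|fi] := eqVneq (f i) 0;
    first exact: freegU0.
  have : (D `&` [set y | f y != 0])%classic i by [].
  by rewrite er /= (negbTE ir).
- move=> i /=; rewrite mem_undup => ir; have : [set` r]%classic i by [].
  by rewrite -er => -[].
rewrite raddf_sum /= big_mkcond /=.
pose v := if x \in D then f x else 0.
transitivity (\sum_(y <- undup r) if y == x then v else 0).
  apply: eq_bigr => y _; rewrite coeffU /v.
  by have [->|_] := eqVneq y x; rewrite ?mulr1 // mulr0 if_same.
have [xr|xr] := boolP (x \in undup r).
  rewrite (bigD1_seq x) ?undup_uniq //= eqxx big1 ?addr0 // => y /negbTE.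
  by move=> ->.
rewrite big1_seq => [|y /andP[_ yr]]; last first.
  by case: eqVneq => // e; move: xr; rewrite -e yr.
rewrite /v; case: ifP => // xD; apply/esym/eqP; apply: contraNT xr => fx.
rewrite mem_undup; have : (D `&` [set y | f y != 0])%classic x by split=> //;
  exact: set_mem.
by rewrite er.
Qed.

Lemma divgroup_eq (T : idomainType) (D E : divgroup T) :
  (forall P, coeff P D = coeff P E) -> D = E.
Proof. by move=> h; apply/eqP/freeg_eqP. Qed.

Section DivOf.
Variables (T : idomainType).
Hypothesis hd : forall P : height1 T, dvr P.
Hypothesis hf : finite_char (@height1_pred T).

Lemma coeff_div_of (a : T) (P : height1 T) : a != 0 ->
  coeff P (div_of a) = (vord P a)%:Z.
Proof.
move=> a0; rewrite /div_of coeff_fsum ?in_setT ?valuationE //.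
apply: sub_finite_set (hf a0) => Q /= [_]; rewrite valuationE //.
by rewrite -lt0n vord_gt0.
Qed.

Lemma div_ofM (a b : T) : a != 0 -> b != 0 ->
  div_of (a * b) = div_of a + div_of b.
Proof.
move=> a0 b0; apply: divgroup_eq => P.
by rewrite coeffD !coeff_div_of ?mulf_neq0 // vordM.
Qed.

Lemma div_of1 : div_of (1 : T) = 0.
Proof. by apply: (addrI (div_of 1));
  rewrite -div_ofM ?oner_eq0 // mulr1 addr0. Qed.

(** The differences div(a) - div(b) already form a subgroup, by [div_ofM]. *)
Lemma principalP (D : divgroup T) :
  D \in @principal T <-> exists a b : T, [/\ a != 0, b != 0
    & D = div_of a - div_of b].
Proof.
split; last first.
  by move=> [a [b [a0 b0 ->]]]; rewrite rpredB //; apply/asboolP => H HZ; apply.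
pose H : {pred divgroup T} := fun D =>
  `[< exists a b : T, [/\ a != 0, b != 0 & D = div_of a - div_of b] >].
move=> /asboolP/(_ H) h; suff : D \in H by move/asboolP.
apply: h.
  split; first by apply/asboolP; exists 1, 1; rewrite oner_eq0 subrr.
  move=> _ _ /asboolP[a [b [a0 b0 ->]]] /asboolP[c [d [c0 d0 ->]]].
  apply/asboolP; exists (a * d), (b * c); rewrite !mulf_neq0 //; split=> //.
  by rewrite !div_ofM // opprB [div_of b + _]addrC opprD addrACA [- _ + -
    _]addrC.
move=> a a0; apply/asboolP; exists a, 1; rewrite oner_eq0; split=> //.
by rewrite div_of1 subr0.
Qed.

Lemma divclass_is_additive : zmod_morphism (@divclass T).
Proof. by move=> D E; rewrite /divclass raddfB. Qed.

Lemma divclass_eq (D E : divgroup T) : divclass D =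
  divclass E <-> D - E \in @principal T.
Proof. by rewrite Quotient.idealrBE; split=> [e|/eqP //]; apply/eqP. Qed.

End DivOf.

Section SemiInvariants.
Variables (A R : idomainType) (kappa : {rmorphism A -> R}).
Variables (gT : finGroupType) (G : {group gT}) (sigma : gT ->
  {rmorphism R -> R}).
Hypothesis kappa_inj : injective kappa.
Hypothesis sigma1 : forall x, sigma 1%g x = x.
Hypothesis sigmaM : forall g h x, g \in G -> h \in G ->
  sigma (g * h)%g x = sigma g (sigma h x).
Hypothesis sigma_kappa : forall g c, g \in G -> sigma g (kappa c) = kappa c.
Hypothesis unit_kappa : forall z w : R, z * w = 1 -> exists c, z = kappa c.
Hypothesis no_chi :
  ~ (exists chi : gT -> {fraction A},
       [/\ forall g, g \in G -> chi g != 0,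
           {in G &, {morph chi : g h / (g * h)%g >-> g * h}}
         & exists2 g, g \in G & chi g != 1]).

(* If every [sigma g] multiplies [a / b] by a unit, these units form a
   character of [G]. *)
Lemma semi_invariant_eq (a b : R) : a != 0 -> b != 0 ->
  (forall g, g \in G -> (exists z, sigma g a * b = a * sigma g b * z) /\
                         (exists z, a * sigma g b = sigma g a * b * z)) ->
  forall g, g \in G -> sigma g a * b = a * sigma g b.
Proof.
move=> a0 b0 hab.
have sigma0 g x : g \in G -> x != 0 -> sigma g x != 0.
  move=> gG; apply: contra_neq => e0.
  by rewrite -[x](sigmaK sigma1 sigmaM gG) e0 rmorph0.
have /choice[c hc] : forall g, exists c, g \in G ->
    c != 0 /\ sigma g a * b = kappa c * (a * sigma g b).
  move=> g; have [gG|_] := boolP (g \in G); last by exists 0.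
  have [[z ez] [w ew]] := hab g gG.
  have t0 : a * sigma g b != 0 by rewrite mulf_neq0 ?sigma0.
  have zw : z * w = 1 by apply: (mulfI t0); rewrite mulrA -ez -ew mulr1.
  have [c ec] := unit_kappa zw; exists c => _; rewrite -ec ez mulrC; split=> //.
  by apply: contra_eq_neq zw => c0;
    rewrite ec c0 rmorph0 mul0r eq_sym oner_neq0.
have c1 g : g \in G -> c g = 1.
  move=> gG; apply: contrapT => /eqP cg1; apply: no_chi.
  exists (fun g => tofrac (c g)); split.
  - by move=> h hG; rewrite tofrac_eq0; have [] := hc h hG.
  (* Since [sigma h] fixes constants, applying it to the equation of [k] and inserting that of [h]
     gives the equation of the product. *)
  - move=> h k hG kG; rewrite -tofracM; congr tofrac.
    have [_ eh] := hc h hG; have [_ ek] := hc k kG;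
      have [_ ehk] := hc _ (groupM hG kG).
    have ghk0 := sigma0 _ _ (groupM hG kG) b0; have gh0 := sigma0 _ _ hG b0.
    apply/kappa_inj/(mulIf (mulf_neq0 a0 ghk0))/(mulIf gh0).
    rewrite -ehk mulrAC rmorphM.
    have := congr1 (sigma h) ek;
      rewrite !rmorphM -!sigmaM // sigma_kappa // => ->.
    transitivity (sigma h a * b * (kappa (c k) * sigma (h * k)%g b));
      first by mulAC.
    by rewrite eh; mulAC.
  - by exists g => //; rewrite -(rmorph1 (@tofrac A)) tofrac_eq.
by move=> g gG; have [_ ->] := hc g gG; rewrite c1 // rmorph1 mul1r.
Qed.

End SemiInvariants.

(** * Extension of divisors and of divisor classes from the invariants *)

Section DivExt.
Variables (R S : idomainType)
    (phi : {rmorphism S -> R}) (gT : finGroupType) (G : {group gT}).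
Variable sigma : gT -> {rmorphism R -> R}.
Hypothesis phi_inj : injective phi.
Hypothesis sigma1 : forall x, sigma 1%g x = x.
Hypothesis sigmaM : forall g h x, g \in G -> h \in G ->
  sigma (g * h)%g x = sigma g (sigma h x).
Hypothesis sigma_phi : forall g x, g \in G -> sigma g (phi x) = phi x.
Hypothesis phi_inv : forall x, (forall g, g \in G -> sigma g x = x) ->
  exists y, phi y = x.
Hypothesis hR : krull R.

Let phi0 (z : S) : z != 0 -> phi z != 0.
Proof. by apply: contra_neq => e; apply: phi_inj; rewrite e rmorph0. Qed.

Let hd (Q : height1 R) : dvr Q. Proof. by have [] := hR. Qed.
Let hf : finite_char (@height1_pred R). Proof. by have [] := hR. Qed.

Let contrQ : height1 R -> height1 S :=
  contracted_prime phi_inj sigma1 sigmaM sigma_phi phi_inv hR.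
Let hdS : forall P : height1 S, dvr P :=
  invariant_dvr phi_inj sigma1 sigmaM sigma_phi phi_inv hR.
Let hfS : finite_char (@height1_pred S) :=
  invariant_finite phi_inj sigma1 sigmaM sigma_phi phi_inv hR.

Let e (Q : height1 R) : nat := vord Q (phi (unif (contrQ Q))).

Let vord_contr (Q : height1 R) (x : S) : x != 0 ->
  vord Q (phi x) = (vord (contrQ Q) x * e Q)%N.
Proof. exact: vord_extension (hd Q) (hdS (contrQ Q)). Qed.

Let contr_surj P : exists Q, P = contrQ Q. Proof. exact: height1_contr. Qed.

Let e_gt0 Q : (0 < e Q)%N.
Proof.
have [_ uq u0 _] := unifP (hdS (contrQ Q)).
by rewrite vord_gt0 // phi0.
Qed.

Lemma coeff_prime_ext q Q : coeff Q (prime_ext phi q) =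
  ((contrQ Q == q) * e Q)%N%:Z.
Proof.
have [x xq x0] := height1_neq0 q.
have fin : finite_set [set Q : height1 R | contraction phi Q =i q]%classic.
  by apply: sub_finite_set (hf (phi0 x0)) => Q' /= cQ';
    rewrite -contractionE cQ'.
rewrite /prime_ext coeff_fsum; last by apply: sub_finite_set fin => y [].
rewrite ramificationE //; last exact: (hdS (contrQ Q)).
have -> : (Q \in [set Q0 : height1 R | contraction phi Q0 =i q]%classic) =
  (contrQ Q == q).
  apply/idP/eqP => [/set_mem /= h|<-]; last by apply/mem_set.
  exact: height1_eq.
by case: eqP => _; rewrite ?mul1n ?mul0n.
Qed.

Lemma divext_additive : zmod_morphism (@divext S R phi).
Proof. exact: lift_is_additive. Qed.

HB.instance Definition _ :=
  GRing.isZmodMorphism.Build _ _ (@divext S R phi) divext_additive.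

Lemma coeff_divext D Q : coeff Q (divext phi D) = coeff (contrQ Q) D * (e Q)%:Z.
Proof.
rewrite -[D in RHS]freeg_sumE -{1}[D]freeg_sumE !raddf_sum /= mulr_suml.
apply: eq_bigr => P _; rewrite coeffU /divext liftU coeffZ coeff_prime_ext
  -mulrA.
by rewrite PoszM eq_sym; case: eqP.
Qed.

Lemma divext_div_of a : a != 0 -> divext phi (div_of a) = div_of (phi a).
Proof.
move=> a0; apply: divgroup_eq => Q.
by rewrite coeff_divext !coeff_div_of ?phi0 // vord_contr.
Qed.

Lemma divext_inj : injective (@divext S R phi).
Proof.
move=> D E h; apply: divgroup_eq => P; have [Q ->] := contr_surj P.
have := congr1 (coeff Q) h; rewrite !coeff_divext => /mulIf; apply.
by rewrite -lt0n e_gt0.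
Qed.

Lemma divext_principal D : D \in @principal S -> divext phi D \in @principal R.
Proof.
move=> /(principalP hdS hfS)[a [b [a0 b0 ->]]].
rewrite divext_additive !divext_div_of //; apply/(principalP hd hf).
by exists (phi a), (phi b); rewrite !phi0.
Qed.

(** A prime and its conjugate have the same contraction and the same ramification index. *)
Lemma coeff_divext_conj D Q g (gG : g \in G) :
  coeff (conj_prime sigma1 sigmaM hR Q gG) (divext phi D) =
    coeff Q (divext phi D).
Proof.
have ec : contrQ (conj_prime sigma1 sigmaM hR Q gG) = contrQ Q.
  by apply: height1_eq; apply: contraction_conj.
rewrite !coeff_divext ec /e ec vord_conj ?sigma_phi //.
by have [_ _ u0 _] := unifP (hdS (contrQ Q)); rewrite phi0.
Qed.

Definition class_ext (c : classgroup S) : classgroup R :=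
  divclass (divext phi (generic_quotient.repr c)).

Lemma class_extE D : class_ext (divclass D) = divclass (divext phi D).
Proof.
apply/divclass_eq; rewrite -divext_additive; apply: divext_principal.
by apply/divclass_eq; rewrite /divclass reprK.
Qed.

Lemma class_ext_additive : zmod_morphism class_ext.
Proof.
elim/quotW => D; elim/quotW => E; rewrite -raddfB.
by rewrite !class_extE divext_additive divclass_is_additive.
Qed.

Hypothesis no_char : forall a b : R, a != 0 -> b != 0 ->
  (forall g, g \in G -> (exists z, sigma g a * b = a * sigma g b * z) /\
                         (exists z, a * sigma g b = sigma g a * b * z)) ->
  forall g, g \in G -> sigma g a * b = a * sigma g b.

Lemma principal_descent D : divext phi D \in @principal R -> D \in @principal S.
Proof.
move=> /(principalP hd hf)[a [b [a0 b0 eD]]].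
have sigma0 g x : g \in G -> x != 0 -> sigma g x != 0.
  move=> gG; apply: contra_neq => e0.
  by rewrite -[x](sigmaK sigma1 sigmaM gG) e0 rmorph0.
have eab : forall g, g \in G -> sigma g a * b = a * sigma g b.
  apply: no_char => // g gG; have ga0 := sigma0 _ _ gG a0;
    have gb0 := sigma0 _ _ gG b0.
  have [_ _ hdiv] := hR.
  (* The divisor of a / b is extended from [S], hence invariant under [G]; so the conjugate fraction
     has the same divisor. *)
  have eq_vord (Q : height1 R) : vord Q (sigma g a * b) =
    vord Q (a * sigma g b).
    have := coeff_divext_conj D Q gG;
      rewrite eD !coeffB !coeff_div_of // !vord_conj //.
    rewrite !vordM // => /eqP.
    by rewrite subr_eq addrAC eq_sym subr_eq -!PoszD eqz_nat eq_sym =>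
      /eqP ->; rewrite addnC.
  by split; apply: hdiv; rewrite ?mulf_neq0 // => Q; rewrite eq_vord.
(* To write the invariant fraction a / b over [S], it is expanded by the cofactor [z] of [b] in its
   norm: the denominator b z becomes invariant, hence so does the numerator a z. *)
have [beta ebeta] := group_norm_invariant sigmaM phi_inv b.
have [z ez] := group_norm_dvd G sigma1 b.
have nb0 := group_norm_neq0 sigma1 sigmaM b0.
have z0 : z != 0 by apply: contraNneq nb0 => z0; rewrite ez z0 mulr0.
have [g gG|alpha ealpha] := phi_inv (x := a * z).
  have gb0 := sigma0 _ _ gG b0.
  apply: (mulIf b0); apply: (mulIf gb0).
  have gnb : sigma g b * sigma g z =
    b * z by rewrite -rmorphM -ez -ebeta sigma_phi.
  transitivity ((sigma g a * b) * (sigma g b * sigma g z));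
    first by rewrite rmorphM; mulAC.
  by rewrite gnb eab //; mulAC.
have alpha0 : alpha != 0.
  by apply: contraTneq (mulf_neq0 a0 z0) => h; rewrite -ealpha h rmorph0 eqxx.
have beta0 : beta != 0.
  by apply: contraNneq nb0 => h; rewrite -ebeta h rmorph0.
apply/(principalP hdS hfS); exists alpha, beta; split=> //.
apply: divext_inj; rewrite divext_additive !divext_div_of // eD ealpha ebeta ez.
by rewrite !div_ofM // opprD addrACA subrr addr0.
Qed.

Lemma class_ext_injective : injective class_ext.
Proof.
elim/quotW => D; elim/quotW => E; rewrite -!/(divclass _) !class_extE.
move/divclass_eq; rewrite -divext_additive => /principal_descent h.
exact/divclass_eq.
Qed.

Lemma exists_class_ext : exists i : {additive classgroup S -> classgroup R},
  is_induced_by_divext phi i /\ injective i.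
Proof.
pose i : {additive classgroup S -> classgroup R} :=
  HB.pack class_ext (GRing.isZmodMorphism.Build _ _ class_ext
    class_ext_additive).
exists i; split; [exact: class_extE|exact: class_ext_injective].
Qed.

End DivExt.

(** * Linear actions on multivariate polynomials *)

Section MpolyFacts.
Variables (A : idomainType) (n : nat).
Implicit Types (f g : {mpoly A[n]}) (m : 'X_{1..n}).

Lemma mcoeff_sumX (s : seq 'X_{1..n}) (t : 'X_{1..n} -> A) k : uniq s ->
  (\sum_(m <- s) t m *: 'X_[m])@_k = if k \in s then t k else 0.
Proof.
elim: s => [|m s IH] /=; first by rewrite big_nil mcoeff0.
move=> /andP[ms us]; rewrite big_cons mcoeffD mcoeffZ mcoeffX IH // inE eq_sym.
have [->|_] := eqVneq k m; last by rewrite mulr0 add0r.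
by rewrite mulr1 (negbTE ms) addr0.
Qed.

(** Degrees add in a product over a domain. This is applied to units, with [c] equal to 1, and to a
    divisor of a uniformizer of a prime of [A]. *)
Lemma mpoly_divisor_const f g c : c != 0 -> f * g = c%:MP -> f = (f@_0%MM)%:MP.
Proof.
move=> c0 e.
have fg0 : f * g != 0 by rewrite e mpolyC_eq0.
have f0 : f != 0 by apply: contraNneq fg0 => ->; rewrite mul0r.
have g0 : g != 0 by apply: contraNneq fg0 => ->; rewrite mulr0.
apply: msize1_polyC; have := congr1 (fun p : {mpoly A[n]} => msize p) e.
rewrite msizeM // msizeC c0 /= => es.
have : (0 < msize g)%N by rewrite lt0n msize_poly_eq0.
by case: (msize g) es => // k; rewrite addnS /= => <- _; exact: leq_addr.
Qed.

Lemma mx_act1 : mx_act (1%:M : 'M[A]_n) =1 id.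
Proof.
move=> p; rewrite /mx_act -[RHS]comp_mpoly_id; congr comp_mpoly.
apply: eq_mktuple => j;
  rewrite (bigD1 j) //= mxE eqxx scale1r big1 ?addr0 // => i ij.
by rewrite mxE (negbTE ij) scale0r.
Qed.

Lemma mx_actX (M : 'M[A]_n) j : mx_act M 'X_j = \sum_i M i j *: 'X_i.
Proof. by rewrite /mx_act comp_mpolyXU -tnth_nth tnth_mktuple. Qed.

Lemma mx_actC (M : 'M[A]_n) c : mx_act M c%:MP = c%:MP.
Proof. exact: comp_mpolyC. Qed.

Lemma mx_actM (M N : 'M[A]_n) p : mx_act (M *m N) p = mx_act M (mx_act N p).
Proof.
apply: (mpoly_rmorph_eq (f := mx_act (M *m N))
    (g := mx_act M \o mx_act N)) => [c|j] /=.
  by rewrite !mx_actC.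
rewrite !mx_actX linear_sum /=.
transitivity (\sum_k \sum_i (M i k * N k j) *: 'X_i : {mpoly A[n]}).
  by rewrite exchange_big; apply: eq_bigr => i _; rewrite mxE scaler_suml.
apply: eq_bigr => k _; rewrite linearZ /= mx_actX scaler_sumr.
by apply: eq_bigr => i _; rewrite scalerA mulrC.
Qed.

End MpolyFacts.

(** * Extension of a prime to polynomials in several variables *)

Section MGauss.
Variables (A : idomainType) (n : nat) (p : {pred A}) (hp : dvr p).
Let pp := dvr_prime hp.
Implicit Types (f g : {mpoly A[n]}) (m : 'X_{1..n}).

(** The extension of [p] to A[X_1, ..., X_n], described by coefficients so that its constants and
    its stability under linear substitutions can be read off. *)
Definition mgauss : {pred {mpoly A[n]}} := fun f => `[< forall m, f@_m \in p >].

Lemma mgaussP f : reflect (forall m, f@_m \in p) (f \in mgauss).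
Proof. exact: asboolP. Qed.

Lemma mgaussC c : (c%:MP \in mgauss) = (c \in p).
Proof.
apply/mgaussP/idP => [/(_ 0%MM)|cp m]; first by rewrite mcoeffC eqxx mulr1.
by rewrite mcoeffC primeMr.
Qed.

Lemma mgaussD f g : f \in mgauss -> g \in mgauss -> f + g \in mgauss.
Proof.
by move=> /mgaussP hf /mgaussP hg; apply/mgaussP => m; rewrite mcoeffD primeD.
Qed.

Lemma mgaussZ c f : (c \in p) || (f \in mgauss) -> c *: f \in mgauss.
Proof.
move=> /orP[cp|/mgaussP hf]; apply/mgaussP => m; rewrite mcoeffZ;
  first exact: primeMr.
exact: primeMl.
Qed.

Lemma mgauss_sum I (r : seq I) (F : I -> {mpoly A[n]}) :
  (forall i, F i \in mgauss) -> \sum_(i <- r) F i \in mgauss.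
Proof.
move=> hF; apply/mgaussP => m; rewrite raddf_sum; apply: prime_sum => // i _.
exact/mgaussP.
Qed.

Lemma mgaussMl a f : f \in mgauss -> a * f \in mgauss.
Proof.
move=> /mgaussP hf; rewrite (mpolyE f) mulr_sumr; apply: mgauss_sum => m.
by rewrite -scalerAr mgaussZ // hf.
Qed.

(** The terms of [f] with coefficient outside [p] are kept; in particular the leading coefficient of
    [f1] lies outside [p]. *)
Lemma mgauss_split f : f \notin mgauss -> exists f1,
  [/\ f1 != 0, f - f1 \in mgauss & forall m, f1@_m != 0 -> f1@_m \notin p].
Proof.
move=> /mgaussP/existsNP[m0 /negP hm0].
pose f1 : {mpoly A[n]} :=
  \sum_(m <- [seq m <- msupp f | f@_m \notin p]) f@_m *: 'X_[m].
have f1E m : f1@_m = if f@_m \notin p then f@_m else 0.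
  rewrite /f1 mcoeff_sumX ?filter_uniq ?msupp_uniq // mem_filter.
  case: ifP => [/andP[-> //]|]; case: ifP => //= fm /negbT;
    rewrite mcoeff_msupp negbK.
  by move/eqP.
exists f1; split.
- apply: contra_neq (notin_prime_neq0 pp hm0).
  by move/(congr1 (mcoeff m0)); rewrite f1E hm0 mcoeff0.
- apply/mgaussP => m; rewrite mcoeffB f1E; case: ifP => [_|/negbFE];
    last by rewrite subr0.
  by rewrite subrr; apply: prime0.
- by move=> m; rewrite f1E; case: ifP => //; rewrite eqxx.
Qed.

(* By [mgauss_split] it suffices to compare leading coefficients. *)
Lemma mgauss_prime : prime_ideal mgauss.
Proof.
split; first split.
- by rewrite -mpolyC0 mgaussC; exact: prime0.
- by rewrite -mpolyC1 mgaussC; exact: prime1.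
- by move=> a u v hu hv; rewrite mgaussD // mgaussMl.
move=> u v uv; rewrite -[_ || _]negbK negb_or; apply/negP => /andP[].
move=> /mgauss_split[u1 [u10 hu hu1]] /mgauss_split[v1 [v10 hv hv1]].
have : u1 * v1 \in mgauss.
  have -> : u1 * v1 = u * v + (- v) * (u - u1) + (- u1) * (v - v1).
    rewrite !mulNr !mulrBr !opprB [v * u]mulrC [v * u1]mulrC.
    by rewrite [u * v + _]addrC subrK addrC subrK.
  apply: mgaussD; [apply: mgaussD => //|]; exact: mgaussMl.
move=> /mgaussP/(_ (mlead u1 + mlead v1)%MM); rewrite mleadcM primeM //.
by rewrite (negbTE (hu1 _ _)) ?(negbTE (hv1 _ _)) // mleadc_eq0.
Qed.

Lemma mgauss_dvr_at : dvr_at mgauss (unif p)%:MP.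
Proof.
have [_ pu u0 _] := unifP hp.
split; rewrite ?mgaussC ?mpolyC_eq0 //; first exact: mgauss_prime.
move=> f f0.
have [|s [k [sp hs [x [r [xf rp e]]]]]] :=
  content_split hp (xs := [seq f@_m | m <- msupp f]).
  exists (mleadc f); last by rewrite mleadc_eq0.
  by apply: map_f; rewrite mlead_supp.
have /choice[t ht] : forall m, exists r, s * f@_m = unif p ^+ k * r.
  move=> m; have [mf|mf] := boolP (m \in msupp f); first by apply: hs;
    apply: map_f.
  by exists 0; rewrite memN_msupp_eq0 // !mulr0.
pose g : {mpoly A[n]} := \sum_(m <- msupp f) t m *: 'X_[m].
have gE m : unif p ^+ k * g@_m = s * f@_m.
  rewrite /g mcoeff_sumX ?msupp_uniq //; case: ifP => [_|/negbT mf];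
    first by rewrite ht.
  by rewrite memN_msupp_eq0 // !mulr0.
exists k, s%:MP, g; split; rewrite ?mgaussC //.
  have [m mf xm] := mapP xf; rewrite xm in e;
    apply: contra rp => /mgaussP/(_ m).
  by have /(mulfI (expf_neq0 k u0)) ->
    : unif p ^+ k * g@_m = unif p ^+ k * r by rewrite gE.
apply/mpolyP => m; rewrite -(rmorphXn (@mpolyC n A)) !mul_mpolyC !mcoeffZ gE //.
Qed.

Lemma mgauss_dvr : dvr mgauss.
Proof. by exists (unif p)%:MP; exact: mgauss_dvr_at. Qed.

Lemma vord_mgaussC c : c != 0 -> vord mgauss c%:MP = vord p c.
Proof.
move=> c0; apply: (vord_dvr_at mgauss_dvr mgauss_dvr_at);
  rewrite ?mpolyC_eq0 //.
have [s [r [sp rp e]]] := vordP hp c0.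
by exists s%:MP, r%:MP;
  rewrite !mgaussC -mpolyCM e mpolyCM (rmorphXn (@mpolyC n A)).
Qed.

Lemma mgauss_stable (M : 'M[A]_n) f : f \in mgauss -> mx_act M f \in mgauss.
Proof.
move=> /mgaussP hf; rewrite (mpolyE f) linear_sum /=; apply: mgauss_sum => m.
by rewrite linearZ /= mgaussZ // hf.
Qed.

End MGauss.

(** The primes generate the group of divisors, so they cannot all be principal. *)
Lemma nonprincipal_prime (T : idomainType) :
  (exists c : classgroup T, c != 0) ->
    exists p : height1 T, << p >> \notin @principal T.
Proof.
move=> [c]; apply: contraPP => /forallNP H.
have {}H p : << p >> \in @principal T by apply: contrapT => /negP; apply: H.
apply/negP; rewrite negbK; elim/quotW: c => D; apply/eqP.
rewrite -(raddf0 (\pi_(classgroup T)%qT)).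
apply/divclass_eq; rewrite subr0 -[D]freeg_sumE rpred_sum // => p _.
have -> : << coeff p D *g p >> =
  << p >> *~ coeff p D by rewrite freegU_mulz intz.
exact: rpredMz.
Qed.

(** * Class groups for a linear action *)

Section InvariantRing.
Variables (A : idomainType) (n : nat) (gT : finGroupType) (G : {group gT}).
Variable rho : mx_representation A G n.
Local Notation R := {mpoly A[n]}.
Local Notation S := (invring rho).
Local Notation phi := (@invring_val A n gT G rho).
Hypothesis hA : krull A.

Let sigma (g : gT) : {rmorphism R -> R} := mx_act (rho g).

Let sigma1 x : sigma 1%g x = x.
Proof. by rewrite -[LHS]/(mx_act (rho 1%g) x) repr_mx1 mx_act1. Qed.

Let sigmaM g h x : g \in G -> h \in G ->
  sigma (g * h)%g x = sigma g (sigma h x).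
Proof.
by move=> gG hG;
  rewrite -[LHS]/(mx_act (rho (g * h)%g) x) repr_mxM // mx_actM. Qed.

Let phi_inj : injective phi. Proof. exact: val_inj. Qed.

Let sigma_phi g (x : S) : g \in G -> sigma g (phi x) = phi x.
Proof. by move=> gG; have /forall_inP/(_ g gG)/eqP := valP x. Qed.

Let phi_inv x : (forall g, g \in G -> sigma g x = x) -> exists y, phi y = x.
Proof.
move=> h; have xi : x \in invariant rho by apply/forall_inP => g gG;
  apply/eqP/h.
by exists (Invring xi).
Qed.

Let hR : krull R := mpoly_krull n hA.
Let hd (Q : height1 R) : dvr Q. Proof. by have [] := hR. Qed.
Let hf : finite_char (@height1_pred R). Proof. by have [] := hR. Qed.
Let hdA (Q : height1 A) : dvr Q. Proof. by have [] := hA. Qed.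
Let hfA : finite_char (@height1_pred A). Proof. by have [] := hA. Qed.

Let contrQ : height1 R -> height1 S :=
  contracted_prime phi_inj sigma1 sigmaM sigma_phi phi_inv hR.
Let hdS : forall P : height1 S, dvr P :=
  invariant_dvr phi_inj sigma1 sigmaM sigma_phi phi_inv hR.

Lemma invring_class_neq0 :
  (exists c : classgroup A, c != 0) -> exists c : classgroup S, c != 0.
Proof.
move=> /nonprincipal_prime[p npp]; apply: contrapT => /forallNP allS.
have hp := hdA p; have [_ up u0 _] := unifP hp.
pose Qof (p' : height1 A) : height1 R := height1_of (mgauss_dvr n (hdA p')).
have QofC (p' : height1 A) (c : A) : c != 0 -> vord (Qof p') c%:MP = vord p' c.
  by move=> c0; apply: (vord_mgaussC n (hdA p')).
have Qof_inj p' : Qof p' = Qof p -> p' = p.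
  move=> e; apply: height1_eq => c.
  rewrite -(mgaussC n (hdA p')) -(mgaussC n (hdA p)).
  by rewrite -[LHS]/(c%:MP \in Qof p') e.
pose Q := Qof p; pose q := contrQ Q.
have princ_q : << q >> \in @principal S.
  have := allS (divclass << q >>) => /negP; rewrite negbK => /eqP e.
  have /divclass_eq : divclass << q >> = divclass (0 : divgroup S).
    by rewrite e /divclass raddf0.
  by rewrite subr0.
have := divext_principal phi_inj sigma1 sigmaM sigma_phi phi_inv hR princ_q.
move=> /(principalP hd hf)[a [b [a0 b0 eab]]].
(* The ramification is 1 because a uniformizer of [p] is invariant. *)
have eQ1 : vord Q (phi (unif q)) = 1%N.
  have [pi epi] : exists pi : S, phi pi = (unif p)%:MP.
    by apply: phi_inv => g gG; apply: mx_actC.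
  have pi0 : pi != 0.
    by apply: contraNneq u0 => e; rewrite -(mpolyC_eq0 n) -epi e rmorph0.
  have : vord Q (unif p)%:MP = (vord q pi * vord Q (phi (unif q)))%N.
    by rewrite -epi; exact: (vord_extension phi_inj (hd Q) (hdS q) pi0).
  rewrite QofC // (vord_at hp (unifP hp)) => /esym/eqP.
  by rewrite muln_eq1 => /andP[_ /eqP].
have coefQ (Q' : height1 R) : coeff Q' (divext phi << q >>) = (Q == Q')%:Z.
  rewrite (coeff_divext phi_inj sigma1 sigmaM sigma_phi phi_inv hR) coeffU
    mul1r -/contrQ.
  have [eqq|neqq] := eqVneq q (contrQ Q'); last first.
    rewrite mul0r; case: eqP => // e; move: neqq; rewrite -e eqxx //.
  (* A prime [Q'] over [q] is a conjugate of [Q]; since [Q] is stable under [G], it is contained in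
     [Q'] and so equal to it. *)
  have [x|g [gG eQ']] :=
    @contraction_sub_conj _ _ _ _ G sigma sigma1 sigmaM phi_inv hR Q Q'.
    by rewrite -[_ \in contraction _ Q']/(x \in contrQ Q') -eqq.
  have -> : Q' = Q.
    apply/esym/height1_eq_sub => x xQ; rewrite eQ'.
    by rewrite -[_ \in _]/(sigma g x \in Q); apply: (mgauss_stable hp).
  by rewrite eqxx eQ1.
have vab (Q' : height1 R) : vord Q' a = (vord Q' b + (Q == Q'))%N.
  have := coefQ Q'; rewrite eab coeffB !coeff_div_of // => /eqP.
  by rewrite subr_eq -PoszD eqz_nat addnC => /eqP.
have [_ _ hdivR] := hR.
(* The quotient [f] of [a] by [b] has value 1 at [Q] and 0 at every other prime; so it divides the
   constant [unif p] and is itself constant. *)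
have [f ef] : exists f, a = b * f by apply: hdivR => // Q';
  rewrite vab leq_addr.
have f0 : f != 0 by apply: contra_neq a0 => f0; rewrite ef f0 mulr0.
have vf (Q' : height1 R) : vord Q' f = (Q == Q').
  by apply/eqP; rewrite -(eqn_add2l (vord Q' b)) -vab ef vordM.
have pi0 : (unif p)%:MP != 0 :> R by rewrite mpolyC_eq0.
have [w ew] : exists w, (unif p)%:MP = f * w.
  apply: hdivR => // Q'; rewrite vf; case: eqP => // <-.
  by rewrite QofC // (vord_at hp (unifP hp)).
have efc := mpoly_divisor_const u0 (esym ew); set c := f@_0%MM in efc.
have c0 : c != 0 by apply: contra_neq f0 => c0; rewrite efc c0 mpolyC0.
case/negP: npp; have -> : << p >> = div_of c.
  (* On constants the valuation of [Qof p'] is that of [p'], so the divisor of [c] on [A] is read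
     off from the values of [f]. *)
  apply: divgroup_eq => p'; rewrite coeffU mul1r coeff_div_of //.
  rewrite -QofC // -efc vf; have [<-|npp'] := eqVneq p p';
    first by rewrite eqxx.
  by case: eqP => // e; move: npp'; rewrite (Qof_inj _ (esym e)) eqxx.
by apply/(principalP hdA hfA); exists c, 1;
  rewrite c0 oner_eq0 (div_of1 hdA hfA) subr0.
Qed.

Lemma invring_class_ext :
  ~ (exists chi : gT -> {fraction A},
       [/\ forall g, g \in G -> chi g != 0,
           {in G &, {morph chi : g h / (g * h)%g >-> g * h}}
         & exists2 g, g \in G & chi g != 1]) ->
  exists i : {additive classgroup S -> classgroup R},
    is_induced_by_divext phi i /\ injective i.
Proof.
move=> no_chi.
apply: (exists_class_ext phi_inj sigma1 sigmaM sigma_phi phi_inv hR) => a b.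
apply: (@semi_invariant_eq A R (@mpolyC n A) gT G sigma) => //.
- by move=> c d /eqP; rewrite mpolyC_eq => /eqP.
- by move=> g c gG; apply: mx_actC.
- by move=> z w zw; exists z@_0%MM; apply: mpoly_divisor_const (oner_neq0 A) zw.
Qed.

End InvariantRing.

Theorem theorem1p13 (A : idomainType) (hA : is_global_ring_of_integers A)
    (n : nat) (gT : finGroupType) (G : {group gT})
    (rho : mx_representation A G n) (rho_inj : {in G &, injective rho})
    (hG : ~ exists chi : gT -> {fraction A},
            [/\ forall g, g \in G -> chi g != 0,
                {in G &, {morph chi : g h / (g * h)%g >-> g * h}}
              & exists2 g, g \in G & chi g != 1]) :
  (exists i : {additive classgroup (invring rho) -> classgroup {mpoly A[n]}},
     is_induced_by_divext (@invring_val A n gT G rho) i /\ injective i) /\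
  ((exists c : classgroup A, c != 0) ->
   exists c : classgroup (invring rho), c != 0).
Proof.
have kA := global_krull hA; split; last exact: invring_class_neq0.
exact: invring_class_ext.
Qed.
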